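(* Let $A$ and $B$ be representation-directed algebras, let $P$ be a left abutment of $A$ and $I$ a right abutment of $B$, both of the same height $h$, and let $\Lambda$ be the gluing of $A$ and $B$ along $P$ and $I$, with projections $\phi:\Lambda\to A$, $\psi:\Lambda\to B$. Then the Auslander--Reiten quiver of $\Lambda$ is, as a quiver, the amalgamated sum $$\Gamma(\Lambda)=\Gamma(B)\coprod_{\triangle}\Gamma(A)$$ of $\Gamma(B)$ and $\Gamma(A)$ under the identification $\triangle=\phi_\ast({}^{P}\!\triangle)=\psi_\ast(\triangle^{I})$ of the foundation of $P$ in $\Gamma(A)$ with the foundation of $I$ in $\Gamma(B)$. Moreover, in this identification, for an indecomposable $\Lambda$-module $M$ the vertex $[M]\in\Gamma(\Lambda)$ corresponds to the vertex $[\phi^!(M)]$ of $\Gamma(A)$ if $M$ is supported in $A$, and to the vertex $[\psi^\ast(M)]$ of $\Gamma(B)$ if $M$ is supported in $B$.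
   Context: $K$ is an algebraically closed field; algebras are basic finite-dimensional unital associative $K$-algebras; modules are finite-dimensional right modules; $D=\operatorname{Hom}_K(-,K)$; paths are composed left to right. An algebra is representation-directed if there is no sequence of nonzero nonisomorphisms $M_0\to\cdots\to M_t$ ($t\ge1$) between indecomposable modules with $M_0\cong M_t$. $\Gamma(\Lambda)$ is the Auslander--Reiten quiver, $[M]$ the vertex of an indecomposable $M$. For an algebra map $\phi:\Lambda\to\Gamma$: $\phi_\ast$ is restriction of scalars, $\phi^\ast=-\otimes_\Lambda\Gamma$, $\phi^!=\operatorname{Hom}_\Lambda(\Gamma,-)$. Abutments. A left abutment of $A$ is a uniserial projective module $P$ such that every submodule of $P$ is projective and, for every indecomposable projective $P'$ not isomorphic to a submodule of $P$, every morphism $U\to P'$ with $U\subseteq P$ factors through the inclusion $U\subseteq P$. A realization of $P$ is $(e_i,f_i)_{i=1}^h$ with $e_1,\dots,e_h$ primitive orthogonal idempotents such that the composition series of $P$ is $0\xrightarrow{f_h=0}e_hA\xrightarrow{f_{h-1}}\cdots\xrightarrow{f_1}e_1A\cong P$, $f_i\in\operatorname{Hom}_A(e_{i+1}A,e_iA)=e_iAe_{i+1}$; $h$ is the height. An indecomposable injective $B$-module $I$ is a right abutment if $D(I)$ is a left abutment over $B^{\mathrm{op}}$; it has a realization $(\epsilon_i,g_{i-1})_{i=1}^h$: a chain of quotient maps $I\cong D(B\epsilon_h)\xrightarrow{g_{h-1}}\cdots\xrightarrow{g_1}D(B\epsilon_1)\xrightarrow{g_0=0}0$ dual to the composition series of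 $D(I)$, with $g_i$ regarded as an element of $\epsilon_iB\epsilon_{i+1}\cong\operatorname{Hom}_B(D(B\epsilon_{i+1}),D(B\epsilon_i))$; $h$ is its height. The foundation ${}^{P}\!\triangle$ is the full subquiver of $\Gamma(A)$ on the classes of nonzero subquotients of $P$; the foundation $\triangle^{I}$ is the full subquiver of $\Gamma(B)$ on the classes of nonzero subquotients of $I$. Both are isomorphic to $\Gamma(KA_h)$. Gluing. $KA_h$ is the path algebra of $1\xrightarrow{\alpha_1}2\to\cdots\xrightarrow{\alpha_{h-1}}h$ with vertex idempotents $t_i$. For fixed realizations, $f_P:A\to KA_h$ is the unique algebra homomorphism with $1-\sum_ie_i\mapsto0$, $e_i\mapsto t_i$, $f_i\mapsto\alpha_i$, and $g_I:B\to KA_h$ is the unique algebra homomorphism with $1-\sum_i\epsilon_i\mapsto0$, $\epsilon_i\mapsto t_i$, $g_i\mapsto\alpha_i$ ($1\le i\le h-1$). The gluing of $A$ and $B$ along $P$ and $I$ is $\Lambda=\{(a,b)\in A\times B\mid f_P(a)=g_I(b)\}$ with natural projections $\phi,\psi$. The identification in the amalgamated sum identifies $[X]\in{}^{P}\!\triangle$ with $[Y]\in\triangle^{I}$ when $\phi_\ast(X)\cong\psi_\ast(Y)$. A $\Lambda$-module is supported in $A$ (resp. in $B$) if it is isomorphic to $\phi_\ast(M)$ with $M\in\operatorname{mod}A$ (resp. $\psi_\ast(N)$ with $N\in\operatorname{mod}B$). *)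

(* Defs.v *)
From HB Require Import structures.
From mathcomp Require Import all_boot all_algebra falgebra.
From mathcomp Require Import boolp classical_sets.

Set Implicit Arguments.
Unset Strict Implicit.
Unset Printing Implicit Defensive.

Import GRing.Theory.
Local Open Scope ring_scope.

Section Span.
Variables (K : fieldType) (V : vectType K).

(* The least subspace containing all vectors satisfying P; it exists by       *)
(* [span_of_ex], so the default value 0 is never used.                        *)
Definition span_of (P : V -> Prop) : {vspace V} :=
  xget 0%VS (fun U : {vspace V} => (forall v, P v -> v \in U) /\
     (forall W : {vspace V}, (forall v, P v -> v \in W) -> (U <= W)%VS)).

Lemma finite_span (P : V -> Prop) : exists2 s : seq V,
  (forall v, v \in s -> P v) & forall v, P v -> v \in <<s>>%VS.
Proof.
pose good d := `[< exists2 s : seq V, (forall v, v \in s -> P v)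
                                    & \dim <<s>> = d >].
have ex0 : exists d, good d.
  by exists 0; apply/asboolP; exists [::]; rewrite // span_nil dimv0.
have bnd d : good d -> (d <= \dim (fullv : {vspace V}))%N.
  by case/asboolP=> s _ <-; rewrite dimvS ?subvf.
case: (ex_maxnP ex0 bnd) => d /asboolP[s sP sd] dmax.
exists s => // v Pv.
have: good (\dim <<v :: s>>).
  by apply/asboolP; exists (v :: s) => // w /[!inE] /predU1P[->|/sP].
move/dmax; rewrite -sd span_cons => le.
have sub : (<<s>> <= <[v]> + <<s>>)%VS by apply: addvSr.
have/eqP-> : <<s>>%VS == (<[v]> + <<s>>)%VS by rewrite eqEdim sub le.
by rewrite (subvP (addvSl _ _)) ?memv_line.
Qed.

Lemma span_of_ex (P : V -> Prop) : exists U : {vspace V},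
  (forall v, P v -> v \in U) /\
  (forall W : {vspace V}, (forall v, P v -> v \in W) -> (U <= W)%VS).
Proof.
have [s sP Ps] := finite_span P; exists <<s>>%VS; split=> // W PW.
by apply/span_subvP => v /sP /PW.
Qed.

Lemma mem_span_of (P : V -> Prop) v : P v -> v \in span_of P.
Proof.
move=> Pv; have [h _] : _ /\ _ := xgetPex 0%VS (span_of_ex P).
exact: h.
Qed.

Lemma span_of_sub (P : V -> Prop) (W : {vspace V}) :
  (forall v, P v -> v \in W) -> (span_of P <= W)%VS.
Proof.
move=> PW; have [_ h] : _ /\ _ := xgetPex 0%VS (span_of_ex P).
exact: h.
Qed.

Lemma span_ofP (P : V -> Prop) :
    P 0 -> (forall k u v, P u -> P v -> P (k *: u + v)) ->
  forall v, v \in span_of P <-> P v.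
Proof.
move=> P0 PD v; split; last exact: mem_span_of.
have [s sP Ps] := finite_span P.
move/(subvP (span_of_sub Ps)) => /(@coord_span _ _ _ (in_tuple s)) ->.
elim/big_rec: _ => // i x _ Px; apply: PD => //; apply: sP.
by rewrite mem_nth.
Qed.

Definition quot (U : {vspace V}) : vectType K := subvs_of (U^C)%VS.
Definition qproj (U : {vspace V}) : 'Hom(V, quot U) :=
  linfun (vsproj (U^C)%VS \o daddv_pi (U^C)%VS U).

Lemma qprojK U : cancel (fun q : quot U => vsval q : V) (qproj U).
Proof.
move=> q; rewrite lfunE /= daddv_pi_id ?vsvalK //; last exact: subvsP.
by rewrite capvC capv_compl.
Qed.

Lemma qproj_eq0 U v : (qproj U v == 0) = (v \in U).
Proof.
have cap0 : (U^C :&: U = 0)%VS by rewrite capvC capv_compl.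
have vin : v \in (U^C + U)%VS by rewrite addvC addv_complf memvf.
rewrite lfunE /= -(inj_eq subvs_inj) /= vsprojK ?memv_pi //.
apply/eqP/idP => [p0|vU].
  by rewrite -(daddv_pi_add cap0 vin) p0 add0r memv_pi.
have := daddv_pi_add cap0 vin.
rewrite [X in _ + X]daddv_pi_id ?capv_compl //.
by move/(canRL (addrK _)); rewrite subrr.
Qed.

End Span.

Section Composition.
Variables (K : fieldType) (U V W : vectType K).

Definition precomp_fun (g : 'Hom(U, V)) (f : 'Hom(V, W)) : 'Hom(U, W) :=
  (f \o g)%VF.
Fact precomp_linear g : linear (precomp_fun g).
Proof. by move=> k f f'; rewrite /precomp_fun comp_lfunDl comp_lfunZl. Qed.
HB.instance Definition _ g :=
  GRing.isLinear.Build K 'Hom(V, W) 'Hom(U, W) _ _ (precomp_linear g).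
Definition precomp g : 'Hom('Hom(V, W), 'Hom(U, W)) := linfun (precomp_fun g).

Lemma precompE g f : precomp g f = (f \o g)%VF.
Proof. by rewrite lfunE. Qed.

Definition postcomp_fun (g : 'Hom(V, W)) (f : 'Hom(U, V)) : 'Hom(U, W) :=
  (g \o f)%VF.
Fact postcomp_linear g : linear (postcomp_fun g).
Proof. by move=> k f f'; rewrite /postcomp_fun comp_lfunDr comp_lfunZr. Qed.
HB.instance Definition _ g :=
  GRing.isLinear.Build K 'Hom(U, V) 'Hom(U, W) _ _ (postcomp_linear g).
Definition postcomp g : 'Hom('Hom(U, V), 'Hom(U, W)) := linfun (postcomp_fun g).

Lemma postcompE g f : postcomp g f = (g \o f)%VF.
Proof. by rewrite lfunE. Qed.

End Composition.
Arguments precomp {K U V} W g.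
Arguments postcomp {K} U {V W} g.

Record rmod (K : fieldType) (A : falgType K) := RMod {
  rcar :> vectType K;
  act : A -> 'End(rcar);            (* act a v is v a *)
  act_linear : linear act;
  act1 : act 1 = \1%VF;
  actM : forall a b, act (a * b) = (act b \o act a)%VF
}.

Section Modules.
Variables (K : fieldType) (A : falgType K).
Implicit Types (M N P X : rmod A).

HB.instance Definition _ M :=
  GRing.isLinear.Build K A 'End(rcar M) _ (@act K A M) (@act_linear K A M).

Definition is_hom M N (f : 'Hom(M, N)) :=
  forall a v, f (act M a v) = act N a (f v).

Definition inj_map M N (f : 'Hom(M, N)) := lker f = 0%VS.
Definition surj_map M N (f : 'Hom(M, N)) := limg f = fullv.

Definition isom M N :=
  exists f : 'Hom(M, N), [/\ is_hom f, inj_map f & surj_map f].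

Definition submod M (U : {vspace M}) := forall a u, u \in U -> act M a u \in U.

Section Sub.
Variables (M : rmod A) (U : {vspace M}) (hU : submod U).

Definition sub_act (a : A) : 'End(subvs_of U) :=
  linfun (vsproj U \o act M a \o vsval).

Lemma sub_actE a u : vsval (sub_act a u) = act M a (vsval u).
Proof. by rewrite lfunE /= vsprojK // hU ?subvsP. Qed.

Fact sub_act_linear : linear sub_act.
Proof.
move=> k a b; apply/lfunP => u; apply: subvs_inj; rewrite sub_actE.
by rewrite !lfunE /= linearP /= !lfunE /= !lfunE /= !vsprojK // hU ?subvsP.
Qed.

Fact sub_act1 : sub_act 1 = \1%VF.
Proof.
by apply/lfunP => u; apply: subvs_inj; rewrite sub_actE act1 !lfunE.
Qed.

Fact sub_actM a b : sub_act (a * b) = (sub_act b \o sub_act a)%VF.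
Proof.
apply/lfunP => u; apply: subvs_inj.
by rewrite sub_actE actM [in RHS]lfunE /= !sub_actE lfunE.
Qed.

Definition sub_rmod : rmod A := RMod sub_act_linear sub_act1 sub_actM.

Definition quot_act (a : A) : 'End(quot U) :=
  (qproj U \o linfun (act M a \o vsval))%VF.

Lemma quot_actE a v : quot_act a (qproj U v) = qproj U (act M a v).
Proof.
rewrite /quot_act comp_lfunE [X in qproj U X]lfunE /=.
apply/eqP; rewrite -subr_eq0 -linearB /= qproj_eq0 -linearB hU //.
by rewrite -qproj_eq0 linearB /= qprojK subrr.
Qed.

Fact quot_act_linear : linear quot_act.
Proof.
move=> k a b; apply/lfunP => q; rewrite -[q]qprojK [in RHS]lfunE /=.
rewrite [in RHS]lfunE /= !quot_actE -linearP /=; congr (qproj U _).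
by rewrite linearP !lfunE /= lfunE.
Qed.

Fact quot_act1 : quot_act 1 = \1%VF.
Proof. by apply/lfunP => q; rewrite -[q]qprojK quot_actE act1 !lfunE. Qed.

Fact quot_actM a b : quot_act (a * b) = (quot_act b \o quot_act a)%VF.
Proof.
apply/lfunP => q; rewrite -[q]qprojK [in RHS]lfunE /= !quot_actE actM.
by rewrite comp_lfunE.
Qed.

Definition quot_rmod : rmod A := RMod quot_act_linear quot_act1 quot_actM.

End Sub.

Fact reg_linear : linear (@amulr K A).
Proof. exact: linearP. Qed.

Fact reg1 : amulr (1 : A) = \1%VF.
Proof. by apply/lfunP => x; rewrite !lfunE /= mulr1. Qed.

Fact regM (a b : A) : amulr (a * b) = (amulr b \o amulr a)%VF.
Proof. by apply/lfunP => x; rewrite !lfunE /= !lfunE /= mulrA. Qed.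

Definition reg : rmod A := RMod reg_linear reg1 regM.

Definition rideal (e : A) : {vspace reg} := limg (amull e).

Fact rideal_submod e : submod (rideal e).
Proof.
move=> a _ /memv_imgP[x _ ->]; apply/memv_imgP; exists (x * a).
  exact: memvf.
by rewrite !lfunE /= mulrA.
Qed.

Definition pmod (e : A) : rmod A := sub_rmod (@rideal_submod e).

Definition indecomposable M :=
  (fullv : {vspace M}) <> 0%VS /\
  forall U V : {vspace M}, submod U -> submod V ->
    (U + V)%VS = fullv -> (U :&: V)%VS = 0%VS -> U = 0%VS \/ V = 0%VS.

Definition uniserial M :=
  forall U V : {vspace M}, submod U -> submod V -> (U <= V)%VS \/ (V <= U)%VS.

Definition projective P :=
  forall M N (p : 'Hom(M, N)) (f : 'Hom(P, N)),
    is_hom p -> surj_map p -> is_hom f ->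
    exists2 g : 'Hom(P, M), is_hom g & (p \o g)%VF = f.

Definition injective_mod X :=
  forall M N (i : 'Hom(M, N)) (f : 'Hom(M, X)),
    is_hom i -> inj_map i -> is_hom f ->
    exists2 g : 'Hom(N, X), is_hom g & (g \o i)%VF = f.

Definition idempotent (e : A) := e * e = e.

Definition primitive (e : A) :=
  [/\ idempotent e, e <> 0 &
    forall e1 e2 : A, idempotent e1 -> idempotent e2 ->
      e1 * e2 = 0 -> e2 * e1 = 0 -> e = e1 + e2 -> e1 = 0 \/ e2 = 0].

Definition primitive_orthogonal n (e : 'I_n -> A) :=
  (forall i, primitive (e i)) /\ (forall i j, i != j -> e i * e j = 0).

Definition basic_algebra :=
  exists (n : nat) (e : 'I_n -> A),
    [/\ primitive_orthogonal e, \sum_i e i = 1 &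
      forall i j, i != j -> ~ isom (pmod (e i)) (pmod (e j))].

Definition nonzero_noniso M N :=
  exists f : 'Hom(M, N), [/\ is_hom f, f <> 0 & ~ (inj_map f /\ surj_map f)].

Definition representation_directed :=
  ~ exists (t : nat) (M : nat -> rmod A),
      [/\ (1 <= t)%N, forall i, (i <= t)%N -> indecomposable (M i),
          forall i, (i < t)%N -> nonzero_noniso (M i) (M i.+1)
        & isom (M 0) (M t)].

Definition left_abutment P :=
  [/\ uniserial P, projective P,
      forall (U : {vspace P}) (hU : submod U), projective (sub_rmod hU) &
      forall P', indecomposable P' -> projective P' ->
        (~ exists (U : {vspace P}) (hU : submod U), isom P' (sub_rmod hU)) ->
        forall (U : {vspace P}) (hU : submod U) (f : 'Hom(sub_rmod hU, P')),
          is_hom f ->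
          exists2 g : 'Hom(P, P'), is_hom g &
            forall u : subvs_of U, f u = g (vsval u)].

Definition maximal_submod M (U V : {vspace M}) :=
  [/\ submod U, submod V, (U <= V)%VS, U <> V &
    forall W : {vspace M}, submod W -> (U <= W)%VS -> (W <= V)%VS ->
      W = U \/ W = V].

(* With h = n.+1, the index i : 'I_n.+1 stands for i + 1 in {1, ..., h}, and  *)
(* f i, for i : 'I_n, goes from position i.+1 (= lift ord0 i) to position i   *)
(* (= widen_ord _ i) and acts by left multiplication; f_h = 0 is left out.    *)
Definition realization P n (e : 'I_n.+1 -> A) (f : 'I_n -> A) :=
  [/\ primitive_orthogonal e,
      forall i : 'I_n,
        e (widen_ord (leqnSn n) i) * f i * e (lift ord0 i) = f i,
      isom (pmod (e ord0)) P,
      forall i : 'I_n,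
        {in rideal (e (lift ord0 i)) &, injective (fun x : A => f i * x)} /\
        @maximal_submod reg (amull (f i) @: rideal (e (lift ord0 i)))%VS
                       (rideal (e (widen_ord (leqnSn n) i)))
    & @maximal_submod reg 0%VS (rideal (e ord_max))].

Definition subquotient X M :=
  exists (U : {vspace M}) (hU : submod U) (f : 'Hom(sub_rmod hU, X)),
    is_hom f /\ surj_map f.

(* For M, N indecomposable this is the set of non-isomorphisms M -> N.        *)
Definition in_rad M N (f : 'Hom(M, N)) :=
  is_hom f /\ forall g : 'Hom(N, M), is_hom g ->
    inj_map (\1 - (g \o f))%VF /\ surj_map (\1 - (g \o f))%VF.

Definition rad M N : {vspace 'Hom(M, N)} := span_of (@in_rad M N).

Definition rad2 M N : {vspace 'Hom(M, N)} :=
  span_of (fun h : 'Hom(M, N) =>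
    exists (Z : rmod A) (f : 'Hom(M, Z)) (g : 'Hom(Z, N)),
      [/\ in_rad f, in_rad g & h = (g \o f)%VF]).

Definition irr_dim M N : nat := (\dim (rad M N) - \dim (rad2 M N))%N.

End Modules.

Arguments representation_directed {K} A.
Arguments basic_algebra {K} A.
Arguments reg {K} A.

Section ChangeOfRings.
Variables (K : fieldType) (L G : falgType K) (phi : {lrmorphism L -> G}).

Section Restriction.
Variable M : rmod G.

Definition res_act (l : L) : 'End(M) := act M (phi l).

Fact res_linear : linear res_act.
Proof. by move=> k a b; rewrite /res_act !linearP. Qed.

Fact res1 : res_act 1 = \1%VF.
Proof. by rewrite /res_act rmorph1 act1. Qed.

Fact resM a b : res_act (a * b) = (res_act b \o res_act a)%VF.
Proof. by rewrite /res_act rmorphM actM. Qed.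

Definition res : rmod L := RMod res_linear res1 resM.

End Restriction.

Definition supported (M : rmod L) := exists N : rmod G, isom M (res N).

Section Coinduction.
Variable M : rmod L.

(* Hom_K(G, M), with (f g)(x) = f (g x) *)
Definition homK_act (g : G) : 'End('Hom(G, M)) := precomp M (amull g).

Lemma homK_actE g f x : homK_act g f x = f (g * x).
Proof. by rewrite /homK_act precompE comp_lfunE lfunE. Qed.

Fact homK_linear : linear homK_act.
Proof.
move=> k a b; apply/lfunP => f; apply/lfunP => x.
rewrite add_lfunE scale_lfunE [in RHS]add_lfunE [in RHS]scale_lfunE.
by rewrite !homK_actE mulrDl -scalerAl linearP.
Qed.

Fact homK1 : homK_act 1 = \1%VF.
Proof.
by apply/lfunP => f; apply/lfunP => x; rewrite homK_actE lfunE /= mul1r.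
Qed.

Fact homKM a b : homK_act (a * b) = (homK_act b \o homK_act a)%VF.
Proof.
apply/lfunP => f; apply/lfunP => x.
by rewrite comp_lfunE !homK_actE mulrA.
Qed.

Definition homK_rmod : rmod G := RMod homK_linear homK1 homKM.

Definition homL : {vspace homK_rmod} :=
  span_of (fun f : 'Hom(G, M) => @is_hom K L (res (reg G)) M f).

Lemma mem_homL (f : 'Hom(G, M)) :
  f \in homL <-> @is_hom K L (res (reg G)) M f.
Proof.
apply: span_ofP => [l x|k u v hu hv l x].
  by rewrite !lfunE /= linear0.
by rewrite !add_lfunE !scale_lfunE hu hv linearP.
Qed.

Fact homL_submod : submod homL.
Proof.
move=> g f /mem_homL hf; apply/mem_homL => l x; rewrite !homK_actE -hf.
by rewrite !lfunE /= mulrA.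
Qed.

(* phi^! M = Hom_L(G, M) *)
Definition coind : rmod G := sub_rmod homL_submod.

End Coinduction.

Section Induction.
Variable M : rmod L.

(* M (x)_K G, realised as Hom_K(Hom_K(M, K), G): m (x) g is the map           *)
(* xi |-> xi(m) g, and G acts by (m (x) g) g' = m (x) (g g').                 *)
Definition tensK : vectType K := 'Hom('Hom(M, K^o), G).

Definition pure_fun (m : M) (g : G) (xi : 'Hom(M, K^o)) : G := (xi m : K) *: g.

Fact pure_fun_linear m g : linear (pure_fun m g).
Proof. by move=> k x y; rewrite /pure_fun !lfunE /= lfunE /= scalerDl scalerA. Qed.
HB.instance Definition _ m g :=
  GRing.isLinear.Build K 'Hom(M, K^o) G _ _ (pure_fun_linear m g).

Definition pure (m : M) (g : G) : tensK := linfun (pure_fun m g).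

Lemma pureE m g xi : (pure m g : 'Hom('Hom(M, K^o), G)) xi = (xi m : K) *: g.
Proof. by rewrite lfunE. Qed.

Definition tensK_act (g : G) : 'End(tensK) := postcomp 'Hom(M, K^o) (amulr g).

Lemma tensK_actE g (t : 'Hom('Hom(M, K^o), G)) xi :
  (tensK_act g t : 'Hom('Hom(M, K^o), G)) xi = t xi * g.
Proof. by rewrite /tensK_act postcompE comp_lfunE lfunE. Qed.

Fact tensK_linear : linear tensK_act.
Proof.
move=> k a b; apply/lfunP => t; apply/lfunP => x.
rewrite add_lfunE scale_lfunE [in RHS]add_lfunE [in RHS]scale_lfunE.
by rewrite !tensK_actE mulrDr -scalerAr.
Qed.

Fact tensK1 : tensK_act 1 = \1%VF.
Proof.
by apply/lfunP => f; apply/lfunP => x; rewrite tensK_actE lfunE /= mulr1.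
Qed.

Fact tensKM a b : tensK_act (a * b) = (tensK_act b \o tensK_act a)%VF.
Proof.
apply/lfunP => f; apply/lfunP => x.
by rewrite comp_lfunE !tensK_actE mulrA.
Qed.

Definition tensK_rmod : rmod G := RMod tensK_linear tensK1 tensKM.

Lemma tensK_act_pure m g g' : tensK_act g' (pure m g) = pure m (g * g').
Proof. by apply/lfunP => xi; rewrite tensK_actE !pureE scalerAl. Qed.

Definition balance : {vspace tensK_rmod} :=
  span_of (fun t : tensK => exists (m : M) (l : L) (g : G),
     t = pure (act M l m) g - pure m (phi l * g)).

Fact balance_submod : submod balance.
Proof.
move=> g t ht.
have: (balance <= tensK_act g @^-1: balance)%VS.
  apply: span_of_sub => _ [m [l [g' ->]]]; rewrite -memv_preim linearB /=.
  rewrite !tensK_act_pure -mulrA; apply: mem_span_of.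
  by exists m, l, (g' * g).
by move/subvP/(_ t ht); rewrite -memv_preim.
Qed.

(* phi^* M = M (x)_L G *)
Definition ind : rmod G := quot_rmod balance_submod.

Definition tens (m : M) (g : G) : ind := qproj balance (pure m g).

Lemma tens_act m g g' : act ind g' (tens m g) = tens m (g * g').
Proof. by rewrite [LHS](quot_actE balance_submod) [act _ _ _]tensK_act_pure. Qed.

Lemma tens_balanced m l g : tens (act M l m) g = tens m (phi l * g).
Proof.
apply/eqP; rewrite -subr_eq0 -linearB qproj_eq0; apply: mem_span_of.
by exists m, l, g.
Qed.

Let b (i : 'I_(\dim {:M})) : M := (vbasis {:M})`_i.
Let bd i : 'Hom(M, K^o) := linfun (coord (vbasis {:M}) i : M -> K^o).

Lemma tens_expand (t : tensK) :
  t = \sum_i pure (b i) ((t : 'Hom('Hom(M, K^o), G)) (bd i)).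
Proof.
apply/lfunP => xi; rewrite sum_lfunE.
have {1}-> : xi = \sum_i (xi (b i) : K) *: bd i.
  apply/lfunP => m; rewrite sum_lfunE.
  rewrite {1}[m](coord_vbasis (memvf m)) linear_sum.
  apply: eq_bigr => i _; rewrite linearZ /= scale_lfunE lfunE /=.
  exact: mulrC.
by rewrite linear_sum; apply: eq_bigr => i _; rewrite pureE linearZ.
Qed.

Lemma ind_universal (N : rmod G) (h : 'Hom(M, N)) :
  @is_hom K L M (res N) h ->
  exists2 k : 'Hom(ind, N), is_hom k /\ forall m, k (tens m 1) = h m &
    forall k' : 'Hom(ind, N),
      is_hom k' -> (forall m, k' (tens m 1) = h m) -> k' = k.
Proof.
move=> hom_h.
pose F i (t : tensK) : N :=
  act N ((t : 'Hom('Hom(M, K^o), G)) (bd i)) (h (b i)).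
have lin_i i : linear (F i).
  move=> k t t'; rewrite /F.
  by rewrite add_lfunE scale_lfunE linearP add_lfunE scale_lfunE.
pose lin_iM i := GRing.isLinear.Build K tensK N _ (F i) (lin_i i).
pose k1 i : {linear tensK -> N} := HB.pack (F i) (lin_iM i).
pose k0 : 'Hom(tensK, N) := \sum_i linfun (k1 i).
have k0E m g : k0 (pure m g) = act N g (h m).
  rewrite sum_lfunE {2}[m](coord_vbasis (memvf m)) !linear_sum.
  apply: eq_bigr => i _; rewrite lfunE /= /F pureE lfunE /=.
  by rewrite !linearZ /= scale_lfunE.
have k0_hom : @is_hom K G tensK_rmod N k0.
  move=> g t; rewrite [t]tens_expand !linear_sum; apply: eq_bigr => i _.
  by rewrite /= tensK_act_pure !k0E actM comp_lfunE.
have k0_bal t : t \in balance -> k0 t = 0.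
  have: (balance <= lker k0)%VS.
    apply: span_of_sub => _ [m [l [g ->]]]; rewrite memv_ker linearB /= !k0E.
    by rewrite hom_h actM comp_lfunE subrr.
  by move/subvP/(_ t) => sub /sub; rewrite memv_ker => /eqP.
pose k : 'Hom(ind, N) := linfun (k0 \o vsval).
have kE t : k (qproj balance t) = k0 t.
  rewrite lfunE /=; apply/eqP; rewrite -subr_eq0 -linearB.
  apply/eqP/k0_bal; rewrite -qproj_eq0 linearB /= qprojK subrr //.
exists k; [split=> [g t|m]|move=> k' hom_k' k'E].
- by rewrite -[t]qprojK [act _ _ _](quot_actE balance_submod) !kE k0_hom.
- by rewrite kE k0E act1 lfunE.
apply/lfunP => q; rewrite -[q]qprojK kE [vsval q]tens_expand !linear_sum.
apply: eq_bigr => i _; rewrite [RHS]k0E -k'E -[LHS]/(k' (tens (b i) _)).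
by rewrite -hom_k' tens_act mul1r.
Qed.

End Induction.
End ChangeOfRings.

Section Opposite.
Variables (K : fieldType) (A : falgType K).

HB.instance Definition _ := Vector.copy A^c A.

Fact opp_scaleAl (k : K) (x y : A^c) : k *: (x * y) = (k *: x : A^c) * y.
Proof. exact: (@scalerAr K A k y x). Qed.
HB.instance Definition _ := GRing.Lmodule_isLalgebra.Build K A^c opp_scaleAl.

Fact opp_scaleAr (k : K) (x y : A^c) : k *: (x * y) = x * (k *: y : A^c).
Proof. exact: (@scalerAl K A k y x). Qed.
HB.instance Definition _ := GRing.Lalgebra_isAlgebra.Build K A^c opp_scaleAr.

Definition opp_alg : falgType K := A^c.

Lemma opp_algM (x y : opp_alg) : x * y = (y : A) * (x : A).
Proof. by []. Qed.

End Opposite.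

Section Dual.
Variables (K : fieldType) (A : falgType K) (M : rmod A).

Definition dual_act (a : opp_alg A) : 'End('Hom(M, K^o)) :=
  precomp K^o (act M (a : A)).

Lemma dual_actE a f x : dual_act a f x = f (act M (a : A) x).
Proof. by rewrite /dual_act precompE comp_lfunE. Qed.

Fact dual_linear : linear dual_act.
Proof.
move=> k a b; apply/lfunP => f; apply/lfunP => x.
rewrite add_lfunE scale_lfunE [in RHS]add_lfunE [in RHS]scale_lfunE.
rewrite !dual_actE (@act_linear K A M k a b) add_lfunE scale_lfunE.
by rewrite linearP.
Qed.

Fact dual1 : dual_act 1 = \1%VF.
Proof.
apply/lfunP => f; apply/lfunP => x; rewrite dual_actE lfunE /=.
by rewrite (@act1 K A M) lfunE.
Qed.

Fact dualM a b : dual_act (a * b) = (dual_act b \o dual_act a)%VF.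
Proof.
apply/lfunP => f; apply/lfunP => x.
by rewrite comp_lfunE !dual_actE opp_algM actM comp_lfunE.
Qed.

(* D M = Hom_K(M, K), a left A-module, i.e. a right module over A^op *)
Definition dual : rmod (opp_alg A) := RMod dual_linear dual1 dualM.

Definition right_abutment :=
  [/\ indecomposable M, injective_mod M & left_abutment dual].

(* Dualising reverses the numbering: the series of D M starts from            *)
(* A eps_h and ends with A eps_1.                                             *)
Definition corealization n (eps : 'I_n.+1 -> A) (g : 'I_n -> A) :=
  @realization K (opp_alg A) dual n
    (fun i => eps (rev_ord i)) (fun i => g (rev_ord i)).

End Dual.

Section PathAlgebra.
Variables (K : fieldType) (n : nat).

(* The vertices of A_h, h = n.+1, are 'I_n.+1, and there is exactly one path  *)
(* from i to j when i <= j. It is encoded by the matrix unit E_ij, so that    *)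
(* concatenation of paths, from left to right, is the matrix product.         *)
Definition KA_space : {vspace 'M[K]_n.+1} :=
  (\sum_(p : 'I_n.+1 * 'I_n.+1 | (p.1 <= p.2)%N) <[delta_mx p.1 p.2]>)%VS.

Lemma KA_path (i j : 'I_n.+1) : (i <= j)%N -> (delta_mx i j : 'M[K]_n.+1) \in KA_space.
Proof.
move=> le; rewrite /KA_space (bigD1 (i, j)) //=.
by rewrite (subvP (addvSl _ _)) ?memv_line.
Qed.

Fact KA_is_aspace : is_aspace KA_space.
Proof.
apply/andP; split.
  apply: has_algid1; rewrite -[1]/(1%:M : 'M_n.+1).
  rewrite [1%:M]matrix_sum_delta; apply: memv_suml => i _.
  apply: memv_suml => j _; rewrite mxE; case: eqP => [->|_].
    by rewrite scale1r KA_path.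
  by rewrite scale0r mem0v.
apply/prodvP => u v /memv_sumP[u' hu ->] /memv_sumP[v' hv ->].
rewrite mulr_suml; apply: memv_suml => -[i j] /= ij.
rewrite mulr_sumr; apply: memv_suml => -[k l] /= kl.
have /vlineP[a ->] := hu (i, j) ij; have /vlineP[b ->] := hv (k, l) kl.
rewrite -scalerAl -scalerAr -mulmxE mul_delta_mx_cond /=.
rewrite !memvZ // mulrb; case: eqP => [jk|_]; last exact: mem0v.
by apply: KA_path; apply: leq_trans ij _; rewrite jk.
Qed.

Definition KA : falgType K := subvs_of (ASpace KA_is_aspace).

Definition KA_idem (i : 'I_n.+1) : KA := vsproj KA_space (delta_mx i i).
Definition KA_arrow (i : 'I_n) : KA :=
  vsproj KA_space (delta_mx (widen_ord (leqnSn n) i) (lift ord0 i)).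

Definition collapse_map (A : falgType K) (e : 'I_n.+1 -> A) (f : 'I_n -> A)
    (F : {lrmorphism A -> KA}) :=
  [/\ F (1 - \sum_i e i) = 0, forall i, F (e i) = KA_idem i
    & forall i, F (f i) = KA_arrow i].

End PathAlgebra.

Section Gluing.
Variables (K : fieldType) (A B C : falgType K).
Variables (f : {lrmorphism A -> C}) (g : {lrmorphism B -> C}).

HB.instance Definition _ := GRing.UnitAlgebra.on (A * B)%type.

Definition glue_diff (x : A * B) : C := f x.1 - g x.2.
Fact glue_diff_linear : linear glue_diff.
Proof.
move=> k x y; rewrite /glue_diff /= !linearP /= scalerBr addrACA; congr (_ + _).
by rewrite scalerN.
Qed.
HB.instance Definition _ :=
  GRing.isLinear.Build K (A * B)%type C _ glue_diff glue_diff_linear.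

Definition glue_space : {vspace (A * B)%type} := lker (linfun glue_diff).

Lemma mem_glue x : (x \in glue_space) = (f x.1 == g x.2).
Proof. by rewrite memv_ker lfunE /= /glue_diff subr_eq0. Qed.

Lemma glue1 : 1 \in glue_space.
Proof. by rewrite mem_glue /= !rmorph1. Qed.

Fact glue_is_aspace : is_aspace glue_space.
Proof.
apply/andP; split; first exact: has_algid1 glue1.
apply/prodvP => u v; rewrite !mem_glue => /eqP hu /eqP hv.
by rewrite (rmorphM f u.1 v.1) (rmorphM g u.2 v.2) /= hu hv.
Qed.

Definition glue_aspace : {aspace (A * B)%type} := ASpace glue_is_aspace.

Definition gluing : falgType K := subvs_of glue_aspace.

Definition glue_phi (x : gluing) : A := (vsval x).1.
Definition glue_psi (x : gluing) : B := (vsval x).2.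

Lemma glue_val1 : vsval (1 : gluing) = 1.
Proof. by rewrite [LHS]/(algid glue_aspace); apply/eqP; rewrite algid_eq1 glue1. Qed.

Fact glue_phi_linear : linear glue_phi. Proof. by []. Qed.
Fact glue_phi_monoid : monoid_morphism glue_phi.
Proof. by split=> //; rewrite /glue_phi glue_val1. Qed.
HB.instance Definition _ :=
  GRing.isLinear.Build K gluing A _ glue_phi glue_phi_linear.
HB.instance Definition _ :=
  GRing.isMonoidMorphism.Build gluing A glue_phi glue_phi_monoid.

Fact glue_psi_linear : linear glue_psi. Proof. by []. Qed.
Fact glue_psi_monoid : monoid_morphism glue_psi.
Proof. by split=> //; rewrite /glue_psi glue_val1. Qed.
HB.instance Definition _ :=
  GRing.isLinear.Build K gluing B _ glue_psi glue_psi_linear.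
HB.instance Definition _ :=
  GRing.isMonoidMorphism.Build gluing B glue_psi glue_psi_monoid.

End Gluing.

Record quiver := Quiver {
  vert : Type;
  arrow : Type;
  src : arrow -> vert;
  tgt : arrow -> vert
}.

Record qmor (Q R : quiver) := QMor {
  qv : vert Q -> vert R;
  qa : arrow Q -> arrow R;
  qmor_src : forall a, src (qa a) = qv (src a);
  qmor_tgt : forall a, tgt (qa a) = qv (tgt a)
}.

Definition qeq Q R (f g : qmor Q R) := qv f =1 qv g /\ qa f =1 qa g.

Definition qiso Q R (f : qmor Q R) := bijective (qv f) /\ bijective (qa f).

Section QComp.
Variables (Q R S : quiver) (g : qmor R S) (f : qmor Q R).

Fact qcomp_src a : src (qa g (qa f a)) = qv g (qv f (src a)).
Proof. by rewrite !qmor_src. Qed.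
Fact qcomp_tgt a : tgt (qa g (qa f a)) = qv g (qv f (tgt a)).
Proof. by rewrite !qmor_tgt. Qed.

Definition qcomp : qmor Q S :=
  @QMor Q S (qv g \o qv f) (qa g \o qa f) qcomp_src qcomp_tgt.
End QComp.

Section FullSubquiver.
Variables (Q : quiver) (S : vert Q -> Prop).

Definition full_subquiver : quiver :=
  @Quiver {x | S x} {a : arrow Q | S (src a) /\ S (tgt a)}
    (fun a => exist S (src (sval a)) (proj1 (svalP a)))
    (fun a => exist S (tgt (sval a)) (proj2 (svalP a))).

Definition full_incl : qmor full_subquiver Q :=
  @QMor full_subquiver Q sval sval (fun _ => erefl) (fun _ => erefl).
End FullSubquiver.

Definition amalgamated_sum D Q1 Q2 Q (i1 : qmor D Q1) (i2 : qmor D Q2)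
    (j1 : qmor Q1 Q) (j2 : qmor Q2 Q) :=
  qeq (qcomp j1 i1) (qcomp j2 i2) /\
  forall (R : quiver) (k1 : qmor Q1 R) (k2 : qmor Q2 R),
    qeq (qcomp k1 i1) (qcomp k2 i2) ->
    exists2 k : qmor Q R, qeq (qcomp k j1) k1 /\ qeq (qcomp k j2) k2 &
      forall k' : qmor Q R, qeq (qcomp k' j1) k1 -> qeq (qcomp k' j2) k2 ->
        qeq k' k.

Section AR.
Variables (K : fieldType) (A : falgType K).

(* An isomorphism class is represented by the predicate of being isomorphic   *)
(* to one of its members.                                                     *)
Definition ar_vertex :=
  {S : rmod A -> Prop | exists2 M, indecomposable M & S = isom M}.

Definition cls (M : rmod A) (hM : indecomposable M) : ar_vertex :=
  exist _ (isom M) (ex_intro2 _ _ M hM erefl).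

Definition ar_repr (x : ar_vertex) : rmod A := s2val (cid2 (svalP x)).

(* As many arrows from [M] to [N] as the dimension of rad(M, N)/rad^2(M, N).  *)
Definition AR : quiver :=
  @Quiver ar_vertex
    {xy : ar_vertex * ar_vertex & 'I_(irr_dim (ar_repr xy.1) (ar_repr xy.2))}
    (fun a => (tag a).1) (fun a => (tag a).2).

Definition foundation (M : rmod A) : quiver :=
  @full_subquiver AR (fun x => subquotient (ar_repr x) M).

Definition foundation_incl (M : rmod A) : qmor (foundation M) AR :=
  full_incl _.

End AR.
Arguments AR {K} A.

(* Main.v *)
From HB Require Import structures.
Require Import Defs.
From mathcomp Require Import all_boot all_algebra falgebra.
From mathcomp Require Import boolp.

Set Implicit Arguments.
Unset Strict Implicit.
Unset Printing Implicit Defensive.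

Import Defs GRing.Theory.
Local Open Scope ring_scope.

(** Let [J] be the kernel of [A -> KA_h] and [e_1, ..., e_h] the idempotents of
    the left abutment [P = e_1 A]. Every nonzero submodule of the uniserial
    module [P] contains its socle, which is generated by the path [f_1 ... f_(h-1)].
    This path does not lie in [J], so [J] meets [P], and then every [e_k A], in 0:
    thus [e_k J = 0]. The extension property of the abutment says that an element
    of [J e_(k+1)] is a multiple of the arrow [f_k]. Hence, for an [A]-module [X],
    the part of [X J] at the vertices of the abutment is generated at the first
    vertex. Such a module over the linear quiver is injective, and [X J] turns out
    to be a direct summand of [X] ([mulJ_split]). The same splitting shows that an
    indecomposable module annihilated by [J] is generated by one vector, hence is a
    subquotient of [P] ([foundationP]). The statements about [B] and [I] follow by
    applying all this to the opposite algebra and to dual modules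
    ([right_abutment_facts]).

    Over the gluing [L], the kernels of [phi] and [psi] annihilate each other, and
    the splittings carry over: for every [L]-module [Z], both [Z (ker psi)] and
    the largest submodule annihilated by [ker phi] are direct summands
    ([mul_ker_psi_split], [phi_sub_summand]). This has three consequences.

    An indecomposable [L]-module is an [A]-module or a [B]-module
    ([indecomposable_supported]); it is both when it is a module over [KA_h], that
    is, when it lies in both foundations.

    For two [A]-modules, composites of two radical maps through an arbitrary
    [L]-module can be replaced by composites through an [A]-module, so the square of
    the radical, and with it the number of arrows, is the same over [A] as over [L]
    ([rad2_phi]); likewise for [B] ([rad2_psi]).

    There is no arrow between an [A]-module and a [B]-module outside of the
    foundations: in one direction all maps vanish ([irr_dim_phi_psi]), in the
    other all maps factor as two radical maps ([irr_dim_psi_phi]).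

    So the quiver of [L] is covered by the full subquivers coming from [A] and [B],
    which meet in the foundations, and every arrow lies in one of them. Such a
    union is an amalgamated sum ([amalgam]). *)

(** * Linear algebra *)

Lemma linear_lfun (K : fieldType) (V W : vectType K) (F : V -> W) :
  linear F -> exists f : 'Hom(V, W), forall x, f x = F x.
Proof.
move=> linF; pose linM := GRing.isLinear.Build K V W _ F linF.
pose F' : {linear V -> W} := HB.pack F linM.
by exists (linfun F') => x; rewrite lfunE.
Qed.

Section LinearAlgebra.
Variables (K : fieldType) (V : vectType K).

Lemma eq0_vspace (U : {vspace V}) : (forall u, u \in U -> u = 0) -> U = 0%VS.
Proof.
move=> U0; apply/eqP; rewrite -subv0; apply/subvP => u /U0->.
exact: mem0v.
Qed.

Lemma eq_fullv (U : {vspace V}) : (forall u, u \in U) -> U = fullv.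
Proof. by move=> UT; apply/eqP; rewrite eqEsubv subvf; apply/subvP. Qed.

Lemma endo_surj (f : 'End(V)) : lker f = 0%VS -> limg f = fullv.
Proof. by move=> /eqP; apply: lker0_limgf. Qed.

End LinearAlgebra.

Section LinearMaps.
Variables (K : fieldType) (V : vectType K).

Lemma lker0_injP (W : vectType K) (f : 'Hom(V, W)) :
  lker f = 0%VS <-> forall x, f x = 0 -> x = 0.
Proof.
split=> [f0 x fx|f0]; last by apply: eq0_vspace => u; rewrite memv_ker => /eqP/f0.
by apply/eqP; rewrite -memv0 -f0 memv_ker fx.
Qed.

Lemma limg_fullP (W : vectType K) (f : 'Hom(V, W)) :
  limg f = fullv <-> forall y, exists x, f x = y.
Proof.
split=> [fT y|fT].
  by have /memv_imgP[x _ ->] : y \in limg f; [rewrite fT memvf | exists x].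
by apply: eq_fullv => y; have [x <-] := fT y; rewrite memv_img ?memvf.
Qed.

Lemma functional_sep (x y : V) :
  (forall xi : 'Hom(V, K^o), xi x = xi y) -> x = y.
Proof.
move=> xy; rewrite [x](coord_vbasis (memvf x)) [y](coord_vbasis (memvf y)).
apply: eq_bigr => i _; congr (_ *: _).
have := xy (linfun (coord (vbasis {:V}) i : V -> K^o)).
by rewrite !lfunE.
Qed.

Lemma bidual (l : 'Hom('Hom(V, K^o), K^o)) :
  exists v : V, forall xi : 'Hom(V, K^o), xi v = l xi.
Proof.
pose b i := (vbasis {:V})`_i.
pose x i : 'Hom(V, K^o) := linfun (coord (vbasis {:V}) i : V -> K^o).
exists (\sum_(i < \dim {:V}) (l (x i) : K) *: b i) => xi; rewrite linear_sum /=.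
have {2}-> : xi = \sum_(i < \dim {:V}) (xi (b i) : K) *: x i.
  apply/lfunP => u; rewrite sum_lfunE {1}[u](coord_vbasis (memvf u)) linear_sum.
  apply: eq_bigr => i _; rewrite linearZ /= scale_lfunE lfunE /=.
  exact: mulrC.
by rewrite linear_sum; apply: eq_bigr => i _; rewrite !linearZ; apply: mulrC.
Qed.

Lemma transpose_ex (T : 'End('Hom(V, K^o))) :
  exists t : 'End(V), forall (xi : 'Hom(V, K^o)) v, xi (t v) = T xi v.
Proof.
have ex v : exists w : V, forall xi : 'Hom(V, K^o), xi w = T xi v.
  have [|l lE] := @linear_lfun _ _ K^o (fun xi : 'Hom(V, K^o) => T xi v).
    by move=> k u u'; rewrite linearP add_lfunE scale_lfunE.
  by have [w wE] := bidual l; exists w => xi; rewrite wE lE.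
have [t tE] := choice ex.
have [|t' t'E] := @linear_lfun _ V V t.
  by move=> k u v; apply: functional_sep => xi; rewrite tE !linearP /= !tE.
by exists t' => xi v; rewrite t'E tE.
Qed.

(** The complements are chosen from the last vertex backwards. Since [U] is
    generated at the start of its support, a vector of [N k] can be corrected by an
    element of [U k] so that its image falls into the complement already chosen at
    the next vertex. *)
Lemma chain_complement n (N U : nat -> {vspace V}) (a : nat -> 'End(V)) :
    (forall k, (k <= n)%N -> (U k <= N k)%VS) ->
    (forall k, (k < n)%N -> (a k @: N k <= N k.+1)%VS) ->
    (forall k, (k < n)%N -> N k = 0%VS \/ (U k.+1 <= a k @: U k)%VS) ->
  exists Q : nat -> {vspace V},
    [/\ forall k, (k <= n)%N -> (U k + Q k = N k)%VS,
        forall k, (k <= n)%N -> (U k :&: Q k = 0)%VS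
      & forall k, (k < n)%N -> (a k @: Q k <= Q k.+1)%VS].
Proof.
elim: n N U a => [|n IHn] N U a UN aN Ua.
  exists (fun=> (N 0%N :\: U 0%N)%VS); split=> // k; rewrite leqn0 => /eqP->.
    by rewrite addvC addv_diff; apply/addv_idPl/(UN 0%N).
  by rewrite capvC capv_diff.
have [Q [UQ UQ0 aQ]] := IHn (N \o S) (U \o S) (a \o S)
  (fun k => UN k.+1) (fun k => aN k.+1) (fun k => Ua k.+1).
pose T := (N 0%N :&: a 0%N @^-1: Q 0%N)%VS.
have sT : (T <= N 0%N)%VS by apply: capvSl.
exists (fun k => if k is k'.+1 then Q k' else (T :\: U 0%N)%VS); split.
- case=> [_|k kn]; last exact: UQ.
  rewrite addvC addv_diff; apply/eqP; rewrite eqEsubv subv_add sT UN //=.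
  apply/subvP => x xN; have [N0|Ua0] := Ua 0%N isT.
    by move: xN; rewrite N0 memv0 => /eqP->; apply: mem0v.
  have : a 0%N x \in (U 1%N + Q 0%N)%VS
    by rewrite UQ // (subvP (aN 0%N isT)) ?memv_img.
  case/memv_addP => _ /(subvP Ua0) /memv_imgP[u uU ->] [q qQ axE].
  rewrite -[x](subrK u) memv_add // memv_cap -memv_preim linearB /= axE.
  by rewrite [_ + q]addrC addrK qQ andbT memvB // (subvP (UN 0%N isT)).
- case=> [_|k kn]; last exact: UQ0.
  by rewrite capvC capv_diff.
case=> [_|k kn]; last exact: aQ.
apply/subvP => _ /memv_imgP[x xT ->].
by have := subvP (diffvSl _ _) _ xT; rewrite memv_cap -memv_preim => /andP[].
Qed.

End LinearMaps.

(** * Modules *)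

Section ModuleBasics.
Variables (K : fieldType) (A : falgType K).
Implicit Types (M N X Y Z : rmod A).

Lemma is_hom_id M : @is_hom K A M M \1%VF.
Proof. by move=> a v; rewrite !lfunE. Qed.

Lemma is_hom_comp X Y Z (g : 'Hom(Y, Z)) (f : 'Hom(X, Y)) :
  is_hom g -> is_hom f -> @is_hom K A X Z (g \o f)%VF.
Proof. by move=> hg hf a v; rewrite !comp_lfunE hf hg. Qed.

Lemma is_homB X Y (g f : 'Hom(X, Y)) :
  is_hom g -> is_hom f -> @is_hom K A X Y (g - f).
Proof. by move=> hg hf a v; rewrite !add_lfunE !opp_lfunE hg hf linearB. Qed.

Lemma isomI M N (f : 'Hom(M, N)) (g : N -> M) :
  is_hom f -> cancel f g -> cancel g f -> isom M N.
Proof.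
move=> hf fK gK; exists f; split=> //.
  by apply/lker0_injP => x fx; rewrite -[x]fK fx -(linear0 f) fK.
by apply/limg_fullP => y; exists (g y).
Qed.

Lemma bij_homV M N (f : 'Hom(M, N)) : is_hom f -> inj_map f -> surj_map f ->
  [/\ is_hom (f^-1)%VF, cancel f (f^-1)%VF & cancel (f^-1)%VF f].
Proof.
move=> hf f0 fT; have fK := lker0_lfunK (introT eqP f0).
have fVK y : f ((f^-1)%VF y) = y by rewrite limg_lfunVK // fT memvf.
split=> // a y.
by rewrite -{1}[y]fVK -hf fK.
Qed.

Lemma isom_refl M : isom M M.
Proof.
by apply: (@isomI _ _ \1%VF id) => [|x|x]; rewrite ?lfunE //; apply: is_hom_id.
Qed.

Lemma isom_sym M N : isom M N -> isom N M.
Proof.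
case=> f [hf f0 fT]; have [h fK fVK] := bij_homV hf f0 fT.
exact: (isomI h fVK fK).
Qed.

Lemma isom_trans N M X : isom M N -> isom N X -> isom M X.
Proof.
move=> [f [hf f0 fT]] [g [hg g0 gT]].
have [_ fK fVK] := bij_homV hf f0 fT; have [_ gK gVK] := bij_homV hg g0 gT.
apply: (@isomI _ _ (g \o f)%VF (fun y => (f^-1)%VF ((g^-1)%VF y))) => [|x|x].
- exact: is_hom_comp.
- by rewrite comp_lfunE gK fK.
- by rewrite comp_lfunE fVK gVK.
Qed.

Lemma limg_submod M N (f : 'Hom(M, N)) (U : {vspace M}) :
  is_hom f -> submod U -> @submod K A N (f @: U)%VS.
Proof.
by move=> hf sU a _ /memv_imgP[u uU ->]; rewrite -hf memv_img ?sU.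
Qed.

Lemma fullv_submod M : submod (fullv : {vspace M}).
Proof. by move=> a u _; apply: memvf. Qed.

Lemma lker_submod M N (f : 'Hom(M, N)) : is_hom f -> @submod K A M (lker f).
Proof. by move=> hf a u; rewrite !memv_ker hf => /eqP->; rewrite linear0. Qed.

Lemma is_hom_qproj M (U : {vspace M}) (sU : submod U) :
  @is_hom K A M (quot_rmod sU) (qproj U).
Proof. by move=> a v; rewrite (quot_actE sU). Qed.

Lemma complement_projector M (U Q : {vspace M}) : submod U -> submod Q ->
    (U + Q = fullv)%VS -> (U :&: Q = 0)%VS ->
  exists p : 'End(M), [/\ is_hom p, forall u, u \in U -> p u = u,
    forall q, q \in Q -> p q = 0 & forall x, p x \in U].
Proof.
move=> sU sQ UQ UQ0; exists (daddv_pi U Q).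
have pU u : u \in U -> daddv_pi U Q u = u by move=> uU; rewrite daddv_pi_id.
have pQ q : q \in Q -> daddv_pi U Q q = 0.
  move=> qQ; have := @daddv_pi_add _ _ U Q q UQ0.
  rewrite UQ memvf [X in _ + X]daddv_pi_id ?[(Q :&: U)%VS]capvC // => /(_ isT).
  by move/(canRL (addrK _)); rewrite subrr.
split=> // [a x|x]; last exact: memv_pi.
have : x \in (U + Q)%VS by rewrite UQ memvf.
case/memv_addP => u uU [q qQ ->]; rewrite !linearD /=.
by rewrite pU ?sU // pQ ?sQ // (pU u) // (pQ q) // linear0.
Qed.

Lemma indecomposable_idem M (p : 'End(M)) : indecomposable M -> @is_hom K A M M p ->
  (forall x, p (p x) = p x) -> p = 0 \/ p = \1%VF.
Proof.
move=> [_ iM] hp pp.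
have p1 : @is_hom K A M M (\1 - p)%VF by apply: is_homB => //; apply: is_hom_id.
have [||||U0|V0] := iM (limg p) (limg (\1 - p)%VF).
- by apply: limg_submod; last exact: fullv_submod.
- by apply: limg_submod; last exact: fullv_submod.
- apply: eq_fullv => x; rewrite -[x](subrK (p x)) addrC.
  rewrite memv_add ?memv_img ?memvf //; apply/memv_imgP; exists x; first exact: memvf.
  by rewrite add_lfunE opp_lfunE lfunE.
- apply: eq0_vspace => u /memv_capP[/memv_imgP[x _ ->] /memv_imgP[y _]].
  rewrite add_lfunE opp_lfunE lfunE /= => E.
  by have := congr1 p E; rewrite linearB /= !pp subrr.
- left; apply/lfunP => x; rewrite zero_lfunE; apply/eqP.
  by rewrite -memv0 -U0 memv_img ?memvf.
right; apply/lfunP => x; apply/eqP; rewrite eq_sym -subr_eq0 -memv0 -V0.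
apply/memv_imgP; exists x; rewrite ?memvf //.
by rewrite add_lfunE opp_lfunE.
Qed.

Lemma idem_indecomposable M : (fullv : {vspace M}) <> 0%VS ->
    (forall p : 'End(M), @is_hom K A M M p -> (forall x, p (p x) = p x) ->
       p = 0 \/ p = \1%VF) ->
  indecomposable M.
Proof.
move=> M0 idem; split=> // U V sU sV UV UV0.
have [p [hp pU pV pM]] := complement_projector sU sV UV UV0.
have [x|p0|p1] := idem p hp; first exact: pU.
  by left; apply: eq0_vspace => u uU; rewrite -(pU u uU) p0 zero_lfunE.
by right; apply: eq0_vspace => v vV; rewrite -(pV v vV) p1 lfunE.
Qed.

Lemma isom_indecomposable M N : isom M N -> indecomposable M -> indecomposable N.
Proof.
move=> [f [hf f0 fT]] iM; have [hV fK fVK] := bij_homV hf f0 fT.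
have [M0 _] := iM; apply: idem_indecomposable => [N0|p hp pp].
  apply: M0; apply: eq0_vspace => x _; rewrite -[x]fK.
  suff -> : f x = 0 by rewrite linear0.
  by apply/eqP; rewrite -memv0 -N0 memvf.
have [||E|E] := @indecomposable_idem M (f^-1 \o (p \o f))%VF iM.
- by apply: is_hom_comp => //; apply: is_hom_comp.
- by move=> x; rewrite !comp_lfunE /= fVK pp.
- left; apply/lfunP => y; have /lfunP/(_ ((f^-1)%VF y)) := E.
  rewrite !comp_lfunE /= fVK !zero_lfunE => /(congr1 f).
  by rewrite fVK linear0.
right; apply/lfunP => y; have /lfunP/(_ ((f^-1)%VF y)) := E.
by rewrite !comp_lfunE /= fVK !lfunE /= => /(congr1 f); rewrite !fVK.
Qed.

(** Fitting's lemma: for large [m], [M] is the direct sum of the kernel and of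
    the image of [u ^ m]. *)
Lemma fitting M (u : 'End(M)) : indecomposable M -> @is_hom K A M M u ->
  lker u = 0%VS \/ lker (\1 - u)%VF = 0%VS.
Proof.
move=> iM hu.
pose w m : 'End(M) := iter m (fun v => u \o v)%VF \1%VF.
have wE m x : w m x = iter m u x.
  by elim: m => [|m /= <-]; rewrite ?comp_lfunE ?lfunE.
have hw m : @is_hom K A M M (w m).
  by elim: m => [|m IHm]; [apply: is_hom_id | apply: is_hom_comp].
pose d m := \dim (limg (w m)).
(* The dimension of the image of the power [m] is minimal, so that the images of
   higher powers no longer shrink. *)
have [m [m_gt0 m_min]] : exists m, (0 < m)%N /\ forall l, (d m <= d (m + l))%N.
  have ex0 : exists k, `[< exists2 m, (0 < m)%N & d m = k >].
    by exists (d 1); apply/asboolP; exists 1.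
  case: (ex_minnP ex0) => k /asboolP[m m_gt0 <-] kmin; exists m; split=> // l.
  by apply: kmin; apply/asboolP; exists (m + l)%N; rewrite ?ltn_addr.
have img : (w m @: limg (w m))%VS = limg (w (m + m)).
  rewrite -limg_comp; congr (_ @: _)%VS; apply/lfunP => x.
  by rewrite comp_lfunE !wE iterD.
have cap0 : (limg (w m) :&: lker (w m) = 0)%VS.
  have := limg_ker_dim (w m) (limg (w m)); rewrite img -/(d (m + m)%N) => dd.
  apply/eqP; rewrite -dimv_eq0 -leqn0 -(leq_add2r (d (m + m)%N)) dd add0n.
  exact: m_min.
have sum : (limg (w m) + lker (w m) = fullv)%VS.
  apply/eqP; rewrite eqEdim subvf (dimv_disjoint_sum cap0) addnC.
  by have := limg_ker_dim (w m) fullv; rewrite capfv /= => ->.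
have [_ splitM] := iM.
have [| |I0|k0] := splitM _ _ _ _ sum cap0.
- by apply: limg_submod => //; apply: fullv_submod.
- exact: lker_submod.
- right; apply/lker0_injP => x; rewrite add_lfunE opp_lfunE lfunE /= => /eqP.
  rewrite subr_eq0 => /eqP ux.
  have : w m x \in limg (w m) by rewrite memv_img ?memvf.
  by rewrite I0 memv0 wE iter_fix // => /eqP.
left; apply/lker0_injP => x ux; have /lker0_injP := k0; apply.
rewrite wE -(prednK m_gt0) iterSr ux -wE linear0 //.
Qed.

End ModuleBasics.

(** * The radical *)

Section Radical.
Variables (K : fieldType) (A : falgType K).
Implicit Types (M N X Y Z : rmod A).

Lemma in_radP M N (f : 'Hom(M, N)) : in_rad f <->
  is_hom f /\ forall g : 'Hom(N, M), is_hom g -> forall x, g (f x) = x -> x = 0.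
Proof.
split=> -[hf radf]; split=> // g hg.
  have [/lker0_injP inj _] := radf g hg; move=> x gfx; apply: inj.
  by rewrite add_lfunE opp_lfunE comp_lfunE gfx lfunE /= subrr.
have inj : lker (\1 - (g \o f))%VF = 0%VS.
  apply/lker0_injP => x; rewrite add_lfunE opp_lfunE comp_lfunE lfunE /= => /eqP.
  by rewrite subr_eq0 eq_sym => /eqP; apply: radf.
by split=> //; apply: endo_surj.
Qed.

Lemma in_rad_compl X Y Z (g : 'Hom(Y, Z)) (f : 'Hom(X, Y)) :
  is_hom g -> in_rad f -> @in_rad K A X Z (g \o f)%VF.
Proof.
move=> hg /in_radP[hf radf]; apply/in_radP; split; first exact: is_hom_comp.
move=> u hu x; rewrite comp_lfunE => E.
by apply: (radf (u \o g)%VF); [apply: is_hom_comp | rewrite comp_lfunE].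
Qed.

(** If [1 - f u g] is injective, then so is [1 - u g f]: a fixed point [x] of
    [u g f] gives the fixed point [f x] of [f u g]. *)
Lemma in_rad_compr X Y Z (g : 'Hom(Y, Z)) (f : 'Hom(X, Y)) :
  in_rad g -> is_hom f -> @in_rad K A X Z (g \o f)%VF.
Proof.
move=> /in_radP[hg radg] hf; apply/in_radP; split; first exact: is_hom_comp.
move=> u hu x; rewrite comp_lfunE => E.
have fx0 : f x = 0.
  apply: (radg (f \o u)%VF); first exact: is_hom_comp.
  by rewrite comp_lfunE E.
by rewrite -E fx0 !linear0.
Qed.

(** By Fitting's lemma, [g f] is injective or [1 - g f] is; the first case makes
    [f] injective. *)
Lemma noninj_in_rad M N (f : 'Hom(M, N)) :
  indecomposable M -> is_hom f -> ~ inj_map f -> in_rad f.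
Proof.
move=> iM hf ninj; apply/in_radP; split=> // g hg x gfx.
have [//||/lker0_injP inj] := @fitting _ _ _ (g \o f)%VF iM.
- exact: is_hom_comp.
- move=> /lker0_injP inj; case: ninj; apply/lker0_injP => y fy.
  by apply: inj; rewrite comp_lfunE fy linear0.
by apply: inj; rewrite add_lfunE opp_lfunE comp_lfunE gfx lfunE /= subrr.
Qed.

Lemma nonsurj_in_rad M N (f : 'Hom(M, N)) :
  indecomposable N -> is_hom f -> ~ surj_map f -> in_rad f.
Proof.
move=> iN hf nsurj; apply/in_radP; split=> // g hg x gfx.
have [|/endo_surj/limg_fullP surj|/lker0_injP inj] :=
  @fitting _ _ _ (f \o g)%VF iN; first exact: is_hom_comp.
  case: nsurj; apply/limg_fullP => y; have [z <-] := surj y.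
  by exists (g z); rewrite comp_lfunE.
rewrite -gfx [f x]inj ?linear0 //.
by rewrite add_lfunE opp_lfunE comp_lfunE gfx lfunE /= subrr.
Qed.

Lemma rad_dim_le M N M' N' : isom M M' -> isom N N' ->
  (\dim (rad M N) <= \dim (rad M' N'))%N /\
  (\dim (rad2 M N) <= \dim (rad2 M' N'))%N.
Proof.
move=> /isom_sym[a [ha _ /limg_fullP aT]] [b [hb /lker0_injP b0 _]].
pose T : 'Hom('Hom(M, N), 'Hom(M', N')) := (precomp N' a \o postcomp M b)%VF.
have TE f : T f = (b \o f \o a)%VF.
  by rewrite comp_lfunE precompE postcompE.
have T0 : lker T = 0%VS.
  apply/lker0_injP => f; rewrite TE => Tf; apply/lfunP => x.
  have [y <-] := aT x; rewrite zero_lfunE; apply: b0.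
  by have := congr1 (fun u : 'Hom(M', N') => u y) Tf; rewrite !comp_lfunE zero_lfunE.
have dimT (U : {vspace 'Hom(M, N)}) (U' : {vspace 'Hom(M', N')}) :
    (U <= T @^-1: U')%VS -> (\dim U <= \dim U')%N.
  move=> sub; have <- : \dim (T @: U) = \dim U.
    by have := limg_ker_dim T U; rewrite T0 capv0 dimv0.
  apply: dimvS; apply/subvP => _ /memv_imgP[u uU ->].
  by rewrite memv_preim (subvP sub).
split; apply: dimT; apply: span_of_sub => f.
  move=> radf; rewrite -memv_preim TE; apply: mem_span_of.
  by apply: in_rad_compr => //; apply: in_rad_compl.
move=> [Z [u [v [radu radv ->]]]]; rewrite -memv_preim TE; apply: mem_span_of.
exists Z, (u \o a)%VF, (b \o v)%VF; split; last by rewrite !comp_lfunA.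
  exact: in_rad_compr.
exact: in_rad_compl.
Qed.

Lemma irr_dim_isom M N M' N' : isom M M' -> isom N N' ->
  irr_dim M N = irr_dim M' N'.
Proof.
move=> iM iN; have [r1 r2] := rad_dim_le iM iN.
have [r3 r4] := rad_dim_le (isom_sym iM) (isom_sym iN).
congr (_ - _)%N; apply/eqP; rewrite eqn_leq; first by rewrite r1 r3.
by rewrite r2 r4.
Qed.

End Radical.

(** * Restriction along a surjective homomorphism *)

Section SurjectiveRestriction.
Variables (K : fieldType) (L G : falgType K) (phi : {lrmorphism L -> G}).
Hypothesis phi_surj : forall g, exists l, phi l = g.
Implicit Types (X Y : rmod G) (M : rmod L).

Lemma is_hom_res X Y (f : 'Hom(X, Y)) :
  @is_hom K L (res phi X) (res phi Y) f <-> is_hom f.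
Proof. by split=> hf a v; [have [l <-] := phi_surj a|]; apply: hf. Qed.

Lemma submod_res X (U : {vspace X}) :
  @submod K L (res phi X) U <-> submod U.
Proof. by split=> sU a v; [have [l <-] := phi_surj a|]; apply: sU. Qed.

Lemma indecomposable_res X : indecomposable (res phi X) <-> indecomposable X.
Proof.
split=> -[X0 iX]; split=> // U V sU sV; apply: iX; exact/submod_res.
Qed.

Lemma isom_res X Y : isom (res phi X) (res phi Y) <-> isom X Y.
Proof. by split=> -[f [hf f0 fT]]; exists f; split=> //; apply/is_hom_res. Qed.

Lemma in_rad_res X Y (f : 'Hom(X, Y)) :
  @in_rad K L (res phi X) (res phi Y) f <-> in_rad f.
Proof.
by split=> -[hf radf]; split=> [|g /is_hom_res hg]; [exact/is_hom_res|exact: radf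
  |exact/is_hom_res|exact: radf].
Qed.

Lemma rad_res X Y : @rad K L (res phi X) (res phi Y) = rad X Y.
Proof.
by apply/eqP; rewrite eqEsubv; apply/andP; split; apply: span_of_sub => f radf;
  apply: mem_span_of; apply/in_rad_res.
Qed.

Definition annihilated M := forall l, phi l = 0 -> forall x, act M l x = 0.

Lemma annihilated_res X : annihilated (res phi X).
Proof. by move=> l l0 x; rewrite /= /res_act l0 linear0 zero_lfunE. Qed.

Lemma annihilated_isom M N : isom M N -> annihilated M -> annihilated N.
Proof.
move=> [f [hf _ /limg_fullP fT]] aM l l0 y; have [x <-] := fT y.
by rewrite -hf aM // linear0.
Qed.

Section Descent.
Variables (M : rmod L) (aM : annihilated M).

Definition desc_act (g : G) : 'End(M) := act M (((linfun phi)^-1)%VF g).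

Lemma desc_actE l x : desc_act (phi l) x = act M l x.
Proof.
apply/eqP; rewrite -subr_eq0 -opp_lfunE -add_lfunE -linearB /=; apply/eqP/aM.
rewrite linearB /=; apply/eqP; rewrite subr_eq0; apply/eqP.
have := @limg_lfunVK _ _ _ (linfun phi) (phi l); rewrite lfunE /=; apply.
by apply/memv_imgP; exists l; rewrite ?memvf // lfunE.
Qed.

Fact desc_linear : linear desc_act.
Proof. by move=> k a b; rewrite /desc_act !linearP. Qed.

Fact desc1 : desc_act 1 = \1%VF.
Proof. by apply/lfunP => x; rewrite -(rmorph1 phi) desc_actE act1. Qed.

Fact descM a b : desc_act (a * b) = (desc_act b \o desc_act a)%VF.
Proof.
have [l <-] := phi_surj a; have [m <-] := phi_surj b; apply/lfunP => x.
by rewrite -rmorphM comp_lfunE !desc_actE actM comp_lfunE.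
Qed.

(** Descent keeps the carrier, so that linear maps and subspaces can be used on
    both sides without transport. *)
Definition desc : rmod G := RMod desc_linear desc1 descM.

Lemma res_desc : isom M (res phi desc).
Proof.
apply: (@isomI _ _ M (res phi desc) (\1%VF : 'End(M)) id) => [a x|x|x]; rewrite ?lfunE //=.
by rewrite /res_act /= desc_actE.
Qed.

(** As [phi] is onto, an [L]-linear map on [G] is determined by its value at 1,
    and this value is arbitrary because [ker phi] annihilates [M]. *)
Lemma res_coind : isom (res phi (coind phi M)) M.
Proof.
have [|ev evE] := @linear_lfun _ (coind phi M) M
  (fun h => (vsval h : 'Hom(G, M)) 1).
  by move=> k h h'; rewrite linearP add_lfunE scale_lfunE.
have homh (h : coind phi M) l : (vsval h : 'Hom(G, M)) (phi l) =
    act M l ((vsval h : 'Hom(G, M)) 1).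
  have /mem_homL hh := subvsP h.
  by rewrite -hh /= /res_act lfunE /= mul1r.
exists ev; split.
- move=> l h; rewrite !evE -homh.
  have -> : vsval (act (res phi (coind phi M)) l h) =
      homK_act M (phi l) (vsval h) by exact: (sub_actE (@homL_submod _ _ _ phi M)).
  by rewrite homK_actE mulr1.
- apply/lker0_injP => h; rewrite evE => h1; apply: subvs_inj; rewrite linear0.
  apply/lfunP => g; have [l <-] := phi_surj g.
  by rewrite homh h1 linear0 zero_lfunE.
apply/limg_fullP => m.
have [|h hE] := @linear_lfun _ G M (fun g => desc_act g m).
  by move=> k a b; rewrite /desc_act !linearP add_lfunE scale_lfunE.
have homh' : h \in homL phi M.
  apply/mem_homL => l g; have [l' <-] := phi_surj g.
  by rewrite /= /res_act lfunE /= -rmorphM !hE !desc_actE actM comp_lfunE.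
exists (vsproj (homL phi M) h).
by rewrite evE vsprojK // hE -(rmorph1 phi) desc_actE act1 lfunE.
Qed.

(** If [M] is annihilated by the kernel, then [m (x) g = (m l) (x) 1] for any
    [l] over [g], so that [m |-> m (x) 1] is onto; the universal property of the
    tensor product provides a left inverse. *)
Lemma res_ind : isom M (res phi (ind phi M)).
Proof.
have [|h hE] := @linear_lfun _ M (ind phi M) (fun m => tens phi m 1).
  move=> k m m'; rewrite /tens -linearP; congr (qproj _ _).
  apply/lfunP => xi; rewrite add_lfunE scale_lfunE !pureE linearP /= scalerDl.
  by rewrite scalerA.
have homid : @is_hom K L M (res phi desc) \1%VF.
  by move=> l m; rewrite !lfunE /= /res_act desc_actE.
have [k [_ kE] _] := @ind_universal _ _ _ phi M desc \1%VF homid.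
exists h; split.
- move=> l m; rewrite !hE tens_balanced mulr1 /= /res_act.
  by rewrite [RHS]tens_act mul1r.
- apply/lker0_injP => m; rewrite hE => /(congr1 k).
  by rewrite kE linear0 lfunE.
have surj m g : exists m', h m' = tens phi m g.
  have [l <-] := phi_surj g; exists (act M l m).
  by rewrite hE tens_balanced mulr1.
apply: eq_fullv => q; rewrite -[q]qprojK [vsval q]tens_expand linear_sum.
apply: memv_suml => i _; have [m' E] := surj ((vbasis {:M})`_i)
  ((vsval q : 'Hom('Hom(M, K^o), G)) (linfun (coord (vbasis {:M}) i : M -> K^o))).
by have := memv_img h (memvf m'); rewrite E.
Qed.

End Descent.

Lemma supportedP M : supported phi M <-> annihilated M.
Proof.
split=> [[X /isom_sym iX]|aM]; first exact: annihilated_isom iX (@annihilated_res X).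
by exists (desc aM); apply: res_desc.
Qed.

End SurjectiveRestriction.

(** * Abutments *)

Section IdealAction.
Variables (K : fieldType) (A : falgType K) (X : rmod A) (J : A -> Prop).

Lemma act_act a b (x : X) : act X b (act X a x) = act X (a * b) x.
Proof. by rewrite actM comp_lfunE. Qed.

Lemma act0 (x : X) : act X 0 x = 0.
Proof. by rewrite linear0 zero_lfunE. Qed.

(** The submodule [X J]. *)
Definition mulJ : {vspace X} :=
  span_of (fun v => exists x a, J a /\ v = act X a x).

Lemma mem_mulJ x a : J a -> act X a x \in mulJ.
Proof. by move=> Ja; apply: mem_span_of; exists x, a. Qed.

Lemma mulJ_submod : (forall a x, J x -> J (x * a)) -> submod mulJ.
Proof.
move=> Jr a x xJ; have : (mulJ <= act X a @^-1: mulJ)%VS.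
  apply: span_of_sub => _ [y [b [Jb ->]]]; rewrite -memv_preim act_act.
  exact/mem_mulJ/Jr.
by move/subvP/(_ x xJ); rewrite -memv_preim.
Qed.

End IdealAction.
Arguments mulJ {K A} X J.

Definition in_ker (U V : zmodType) (F : U -> V) u := F u = 0.

Lemma mulJ_ker_submod (K : fieldType) (L G : falgType K)
    (phi : {lrmorphism L -> G}) (Z : rmod L) : submod (mulJ Z (in_ker phi)).
Proof.
by apply: mulJ_submod => l x; rewrite /in_ker rmorphM /= => ->; rewrite mul0r.
Qed.

Section Cyclic.
Variables (K : fieldType) (A : falgType K) (M : rmod A).

Lemma reg_hom (m : M) : exists h : 'Hom(reg A, M),
  @is_hom K A (reg A) M h /\ forall a, h a = act M a m.
Proof.
have [|h hE] := @linear_lfun _ (reg A) M (fun a => act M a m).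
  by move=> k a b; rewrite linearP add_lfunE scale_lfunE.
exists h; split=> // a b; rewrite !hE -comp_lfunE -actM.
by rewrite [act (reg A) a b]lfunE.
Qed.

Lemma rideal_mem (e x : A) : e * e = e -> (x \in rideal e) = (e * x == x).
Proof.
move=> ee; apply/idP/eqP => [/memv_imgP[y _ ->]|<-].
  by rewrite !lfunE /= mulrA ee.
by apply/memv_imgP; exists x; rewrite ?memvf // lfunE.
Qed.

Lemma pmod_hom (e : A) (m : M) : exists h : 'Hom(pmod e, M),
  is_hom h /\ forall x, h x = act M (vsval x) m.
Proof.
have [h [hh hE]] := reg_hom m.
have [|h' hE'] := @linear_lfun _ (pmod e) M (fun x => h (vsval x)).
  by move=> k a b; rewrite !linearP.
exists h'; split=> [a x|x]; last by rewrite hE' hE.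
by rewrite !hE' -hh (sub_actE (@rideal_submod _ _ e)).
Qed.

End Cyclic.

Lemma pmod_projective (K : fieldType) (A : falgType K) (e : A) :
  e * e = e -> projective (pmod e).
Proof.
move=> ee M N p h hp /limg_fullP pT hh.
have e_in : e \in rideal e by rewrite rideal_mem // ee.
have [m pm] := pT (h (vsproj (rideal e) e)).
have [g [hg gE]] := pmod_hom e m; exists g => //; apply/lfunP => x.
rewrite comp_lfunE gE hp pm -hh; congr (h _); apply: subvs_inj.
rewrite (sub_actE (@rideal_submod _ _ e)) vsprojK // lfunE /=.
by apply/eqP; rewrite -rideal_mem // subvsP.
Qed.

Section Abutment.
Variables (K : fieldType) (A : falgType K) (P : rmod A) (n : nat).
Variables (e : 'I_n.+1 -> A) (f : 'I_n -> A).
Hypotheses (abutP : left_abutment P) (realP : realization P e f).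

(** Indices are extended to all natural numbers by 0, so that paths can be
    defined by recursion on their length. *)
Definition idem_at k : A := oapp e 0 (insub k).
Definition arrow_at k : A := oapp f 0 (insub k).
Local Notation eN := idem_at.
Local Notation fN := arrow_at.

Lemma idem_at_ord (i : 'I_n.+1) : eN i = e i.
Proof. by rewrite /eN valK. Qed.

Lemma idem_at_out k : (n < k)%N -> eN k = 0.
Proof. by move=> nk; rewrite /eN insubF // ltnS leqNgt nk. Qed.

Lemma idem_atM k l : eN k * eN l = if k == l then eN k else 0.
Proof.
have [[prim orth] _ _ _ _] := realP; rewrite /eN.
case: insubP => [i _ ik|_]; last by rewrite mul0r if_same.
case: insubP => [j _ jl|nl] /=; last first.
  by rewrite mulr0; case: eqP nl => // <-; rewrite -ik ltn_ord.
rewrite -ik -jl (inj_eq val_inj); case: eqVneq => [->|/orth//].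
by have [] := prim j.
Qed.

Lemma idem_arrow k : eN k * fN k * eN k.+1 = fN k.
Proof.
have [_ efe _ _ _] := realP; rewrite /fN.
case: insubP => [i _ ik|_]; last by rewrite mulr0 mul0r.
rewrite /= -[RHS](efe i) -!idem_at_ord /= -ik /bump leq0n.
by rewrite add1n.
Qed.

Lemma idem_arrowl k : eN k * fN k = fN k.
Proof. by rewrite -idem_arrow !mulrA idem_atM eqxx. Qed.

Lemma idem_arrowr k : fN k * eN k.+1 = fN k.
Proof. by rewrite -idem_arrow -!mulrA idem_atM eqxx. Qed.

Fixpoint path_at k m : A :=
  if m is m'.+1 then path_at k m' * fN (k + m') else eN k.
Local Notation pth := path_at.

Lemma idem_pathl k m : eN k * pth k m = pth k m.
Proof. by elim: m => [|m IHm] /=; rewrite ?mulrA ?IHm // idem_atM eqxx. Qed.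

Lemma idem_pathr k m : pth k m * eN (k + m) = pth k m.
Proof.
by case: m => [|m] /=; rewrite ?addn0 ?idem_atM ?eqxx // addnS -mulrA idem_arrowr.
Qed.

(** Left multiplication by [f_1 ... f_k] embeds the projective module at the
    vertex [k] into [P]. *)
Lemma path_inj k x : (k <= n)%N -> eN k * x = x -> pth 0 k * x = 0 -> x = 0.
Proof.
have [_ _ _ inj _] := realP.
elim: k x => [|k IHk] x kn ex /=; first by rewrite ex.
rewrite add0n -mulrA => /IHk fx.
have {fx} fx : fN k * x = 0 by apply: fx; [apply: ltnW|rewrite mulrA idem_arrowl].
pose i := Ordinal kn; have [inj_i _] := inj i.
have eE : e (lift ord0 i) = eN k.+1 by rewrite -idem_at_ord.
apply: inj_i; rewrite ?eE ?rideal_mem ?idem_atM ?eqxx ?ex ?mulr0 //.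
by rewrite -[RHS]fx /fN (insubT (fun k => k < n)%N kn).
Qed.

(** The properties of the kernel of the homomorphism onto the path algebra of
    the linear quiver from which the representation theory follows. They make
    sense for an algebra and for its opposite alike. *)
Record collapse_kernel (J : A -> Prop) : Prop := CollapseKernel {
  kernel_left_ideal : forall a x, J x -> J (a * x);
  kernel_right_ideal : forall a x, J x -> J (x * a);
  kernel_outer : J (1 - \sum_i e i);
  kernel_path : ~ J (pth 0 n);
  kernel_corner : forall a k l, (k <= n)%N -> (l <= n)%N ->
     exists c, J (eN k * a * eN l - c *: (if (k <= l)%N then pth k (l - k) else 0))
}.

Variable J : A -> Prop.
Hypothesis kerJ : collapse_kernel J.
Let Jl := kernel_left_ideal kerJ.
Let Jr := kernel_right_ideal kerJ.
Let Jw := kernel_outer kerJ.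
Let Jpath := kernel_path kerJ.
Let Jgen := kernel_corner kerJ.

Lemma sum_idem : \sum_i e i = \sum_(k < n.+1) eN k.
Proof. by apply: eq_bigr => i _; rewrite idem_at_ord. Qed.

(** [P] is cyclic, with the annihilator of [e_1]; working with this generator
    replaces homomorphisms out of [P] by elements of [A]. *)
Lemma abutment_generator : exists g0 : P,
  (forall v, exists a, v = act P a g0) /\
  (forall a, act P a g0 = 0 <-> eN 0 * a = 0).
Proof.
have [_ _ [th [hth th0 thT]] _ _] := realP.
have ee : e ord0 * e ord0 = e ord0 by rewrite -!idem_at_ord idem_atM.
have e_in : e ord0 \in rideal (e ord0) by rewrite rideal_mem // ee.
pose E : pmod (e ord0) := vsproj (rideal (e ord0)) (e ord0).
have Ea a : vsval (act (pmod (e ord0)) a E) = e ord0 * a.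
  by rewrite (sub_actE (@rideal_submod _ _ (e ord0))) vsprojK // lfunE.
exists (th E); split=> [v|a].
  have /limg_fullP/(_ v)[x <-] := thT; exists (vsval x).
  rewrite -hth; congr (th _); apply: subvs_inj; rewrite Ea; apply/esym/eqP.
  by rewrite -rideal_mem // subvsP.
rewrite -hth (idem_at_ord ord0); split=> [|ea].
  by have /lker0_injP h := th0 => /h E0; rewrite -Ea E0 linear0.
rewrite [X in th X](_ : _ = 0) ?linear0 //; apply: subvs_inj.
by rewrite Ea ea linear0.
Qed.

(** Every nonzero submodule of the uniserial module [P] contains its socle,
    which is generated by the longest path; so an ideal that avoids this path
    meets [P] in 0. *)
Lemma J_socle x : eN 0 * x = x -> J x -> x = 0.
Proof.
move=> ex Jx; apply/eqP; case: eqVneq => // x0; case: Jpath.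
have [uniP _ _ _] := abutP; have [_ _ _ _ [_ _ _ _ simple]] := realP.
have [g0 [_ g00]] := abutment_generator.
have gE a b : act P a g0 = act P b g0 -> eN 0 * a = eN 0 * b.
  move=> ab; apply/eqP; rewrite -subr_eq0 -mulrBr; apply/eqP/g00.
  by rewrite linearB add_lfunE opp_lfunE ab subrr.
have [hx [hhx hxE]] := reg_hom (act P x g0).
have [hp [hhp hpE]] := reg_hom (act P (pth 0 n) g0).
have sub_img (h : 'Hom(reg A, P)) : @is_hom K A (reg A) P h -> submod (limg h).
  by move=> hh; apply: limg_submod => //; apply: fullv_submod.
have [sub|sub] := uniP _ _ (sub_img _ hhx) (sub_img _ hhp); last first.
  have /(subvP sub)/memv_imgP[a _] : act P (pth 0 n) g0 \in limg hp.
    by apply/memv_imgP; exists 1; rewrite ?memvf // hpE act1 lfunE.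
  rewrite hxE -comp_lfunE -actM => /gE; rewrite idem_pathl mulrA ex => ->.
  exact: Jr.
have /(subvP sub)/memv_imgP[a _] : act P x g0 \in limg hx.
  by apply/memv_imgP; exists 1; rewrite ?memvf // hxE act1 lfunE.
rewrite hpE -comp_lfunE -actM => /gE; rewrite mulrA ex idem_pathl => xE.
pose y := eN n * a.
have {}xE : x = pth 0 n * y by rewrite /y mulrA -[n in eN n]add0n idem_pathr.
have eny : eN n * y = y by rewrite /y mulrA idem_atM eqxx.
have enn : e ord_max * e ord_max = e ord_max by rewrite -!idem_at_ord idem_atM eqxx.
have [hy [hhy hyE]] := reg_hom (y : reg A).
have {}hyE b : hy b = y * b by rewrite hyE lfunE.
have [|||W0|WT] := simple (limg hy).
- by apply: limg_submod => //; apply: fullv_submod.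
- exact: sub0v.
- apply/subvP => _ /memv_imgP[b _ ->].
  by rewrite hyE rideal_mem // -idem_at_ord mulrA eny.
- case/eqP: x0; rewrite xE; suff -> : y = 0 by rewrite mulr0.
  apply/eqP; rewrite -(memv0 (y : reg A)) -W0 -[y in X in X \in _]mulr1 -hyE.
  by rewrite memv_img ?memvf.
have : e ord_max \in limg hy by rewrite WT rideal_mem // enn.
case/memv_imgP => b _; rewrite hyE -idem_at_ord /= => eE.
have <- : x * b = pth 0 n by rewrite xE -mulrA -eE -[n in eN n]add0n idem_pathr.
exact: Jr.
Qed.

(** [path_inj] moves the question to the first vertex, where [J_socle] applies. *)
Lemma idem_J k x : J x -> eN k * x = 0.
Proof.
move=> Jx; have [kn|nk] := leqP k n; last by rewrite idem_at_out ?mul0r.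
apply: (@path_inj k); rewrite ?mulrA ?idem_atM ?eqxx //.
by apply: J_socle; [rewrite !mulrA idem_pathl | apply: Jl].
Qed.

Let w := 1 - \sum_i e i.

Lemma J_left_unit x : J x -> w * x = x.
Proof.
move=> Jx; rewrite mulrBl mul1r mulr_suml big1 ?subr0 // => i _.
by rewrite -idem_at_ord idem_J.
Qed.

Lemma abutment_J a v : J a -> act P a v = 0.
Proof.
have [g0 [gen g00]] := abutment_generator.
move=> Ja; have [b ->] := gen v; rewrite -comp_lfunE -actM.
by apply/g00; apply: idem_J; apply: Jl.
Qed.

Lemma abutment_embed k g0 : (k <= n)%N ->
    (forall a, act P a g0 = 0 <-> eN 0 * a = 0) ->
  exists rho : 'Hom(pmod (eN k), P), [/\ is_hom rho, inj_map rho
    & forall x, rho x = act P (pth 0 k * vsval x) g0].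
Proof.
move=> kn g00; have [rho [hrho rhoE]] := pmod_hom (eN k) (act P (pth 0 k) g0).
have {}rhoE x : rho x = act P (pth 0 k * vsval x) g0.
  by rewrite rhoE actM comp_lfunE.
exists rho; split=> //; apply/lker0_injP => x; rewrite rhoE => /g00.
rewrite mulrA idem_pathl => px0; apply: subvs_inj; rewrite linear0.
apply: (path_inj kn) => //; apply/eqP.
by rewrite -rideal_mem ?idem_atM ?eqxx ?subvsP.
Qed.

(** The extension property of an abutment, read off in the algebra. The
    idempotent [u] is cut down to indecomposable summands, since the property
    only speaks of indecomposable projectives; none of them embeds in [P],
    which is annihilated by [u]. *)
Lemma abutment_extend u k x : u * u = u -> J u -> (k <= n)%N ->
    u * x = x -> x * eN k = x ->
  exists2 y, u * y = y & x = y * pth 0 k.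
Proof.
move: {2}(\dim (rideal u)) (leqnn (\dim (rideal u))) => d.
elim: d u x => [|d IHd] u x dimu uu Ju kn ux xk.
  exists 0; rewrite ?mulr0 ?mul0r //; rewrite leqn0 dimv_eq0 in dimu.
  by apply/eqP; rewrite -(memv0 (x : reg A)) -(eqP dimu) rideal_mem ?ux.
have u_in : u \in rideal u by rewrite rideal_mem // uu.
have valK a : a \in rideal u -> u * a = a by rewrite rideal_mem // => /eqP.
have valP (a : pmod u) : u * vsval a = vsval a by rewrite valK ?subvsP.
have actE a b : vsval (act (pmod u) a b) = vsval b * a.
  by rewrite (sub_actE (@rideal_submod _ _ u)) lfunE.
have [ind|nind] := pselect (indecomposable (pmod u)); last first.
  have [u0|/eqP u0] := eqVneq u 0.
    by exists 0; rewrite ?mulr0 ?mul0r // -ux u0 mul0r.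
  have T0 : (fullv : {vspace pmod u}) <> 0%VS.
    move=> T0; apply: u0; rewrite -(vsprojK u_in).
    suff -> : vsproj (rideal u) u = 0 by rewrite linear0.
    by apply/eqP; rewrite -memv0 -T0 memvf.
  have [U [V [sU sV UV UV0 UVn]]] : exists U V : {vspace pmod u},
      [/\ submod U, submod V, (U + V = fullv)%VS, (U :&: V = 0)%VS
        & ~ (U = 0%VS \/ V = 0%VS)].
    apply: contrapT => nUV; apply: nind; split=> // U V sU sV UV UV0.
    by apply: contrapT => UVn; apply: nUV; exists U, V.
  have : vsproj (rideal u) u \in (U + V)%VS by rewrite UV memvf.
  case/memv_addP => a aU [b bV] /(congr1 vsval); rewrite vsprojK //= => uE.
  (* The components of [u] in [U] and [V] are orthogonal idempotents. *)
  have part (U' V' : {vspace pmod u}) a' b' : submod U' -> submod V' ->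
      (U' :&: V' = 0)%VS -> a' \in U' -> b' \in V' ->
      u = vsval a' + vsval b' -> ~ V' = 0%VS -> (U' + V' = fullv)%VS ->
      [/\ vsval a' * vsval a' = vsval a', vsval b' * vsval a' = 0
        & vsval b' <> 0].
    move=> sU' sV' UV0' aU' bV' uE' V0' UV'.
    have uz (z : pmod u) : vsval z = vsval a' * vsval z + vsval b' * vsval z.
      by rewrite -mulrDl -uE' valP.
    have ba0 : vsval b' * vsval a' = 0.
      rewrite -actE; suff -> : act (pmod u) (vsval a') b' = 0 by [].
      apply/eqP; rewrite -memv0 -UV0' memv_cap sV' // andbT.
      suff -> : act (pmod u) (vsval a') b' = a' - act (pmod u) (vsval a') a'.
        by rewrite memvB ?sU'.
      apply: subvs_inj; rewrite linearB /= !actE.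
      by rewrite [X in X - _]uz addrC addKr.
    split=> // [|b0]; first by rewrite [RHS]uz ba0 addr0.
    apply: V0'; apply: eq0_vspace => v vV; apply/eqP.
    rewrite -memv0 -UV0' memv_cap vV andbT.
    suff -> : v = act (pmod u) (vsval v) a' by apply: sU'.
    by apply: subvs_inj; rewrite actE [LHS]uz b0 mul0r addr0.
  have nU : ~ U = 0%VS by move=> U0; apply: UVn; left.
  have nV : ~ V = 0%VS by move=> V0; apply: UVn; right.
  have [aa ba b0] := part U V a b sU sV UV0 aU bV uE nV UV.
  have [bb ab a0] : [/\ vsval b * vsval b = vsval b, vsval a * vsval b = 0
      & vsval a <> 0].
    by apply: (part V U) => //; rewrite 1?capvC 1?addrC 1?addvC.
  have step (c c' : pmod u) : vsval c * vsval c = vsval c ->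
      vsval c * vsval c' = 0 -> vsval c' <> 0 ->
      exists2 y, vsval c * y = y & vsval c * x = y * pth 0 k.
    move=> cc cc' c'0; apply: IHd => //.
    - rewrite -ltnS; apply: leq_trans dimu.
      have sub : (rideal (vsval c) <= rideal u)%VS.
        apply/subvP => z; rewrite rideal_mem // => /eqP <-.
        by rewrite rideal_mem // mulrA valP.
      rewrite ltnNge; apply/negP => le; apply: c'0.
      have /eqP E : rideal (vsval c) == rideal u by rewrite eqEdim sub.
      have : vsval c' \in rideal (vsval c) by rewrite E subvsP.
      by rewrite rideal_mem // cc' => /eqP.
    - by rewrite -(valP c); apply: Jr.
    - by rewrite mulrA cc.
    - by rewrite -mulrA xk.
  have [y1 ay1 xa] := step a b aa ab b0.
  have [y2 by2 xb] := step b a bb ba a0.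
  exists (y1 + y2); last by rewrite mulrDl -xa -xb -mulrDl -uE ux.
  rewrite mulrDr; congr (_ + _); first by rewrite -ay1 mulrA valP.
  by rewrite -by2 mulrA valP.
(* [rho] embeds [e_k A] into [P]; the extension [g] of [rho z |-> x z] to [P] sends
   the generator to the required [y]. *)
have [g0 [_ g00]] := abutment_generator.
have [rho [hrho rho0 rhoE]] := abutment_embed kn g00.
have rhoK := lker0_lfunK (introT eqP rho0).
have [_ _ _ extP] := abutP.
have sU : submod (limg rho) by apply: limg_submod => //; apply: fullv_submod.
have ek_in : eN k \in rideal (eN k) by rewrite rideal_mem ?idem_atM ?eqxx.
pose E : pmod (eN k) := vsproj (rideal (eN k)) (eN k).
have xin z : x * z \in rideal u by rewrite rideal_mem // mulrA ux.
have [|h hE] := @linear_lfun _ (sub_rmod sU) (pmod u)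
  (fun z => vsproj (rideal u) (x * vsval ((rho^-1)%VF (vsval z)))).
  move=> c z z'; apply: subvs_inj; rewrite [RHS]linearP /= !vsprojK //.
  by rewrite !linearP /= mulrDr scalerAr.
have hV a z : z \in limg rho ->
    vsval ((rho^-1)%VF (act P a z)) = vsval ((rho^-1)%VF z) * a.
  case/memv_imgP => t _ ->; rewrite -hrho !rhoK.
  by rewrite (sub_actE (@rideal_submod _ _ (eN k))) lfunE.
have hh : is_hom h.
  move=> a z; rewrite !hE; apply: subvs_inj; rewrite actE !vsprojK //.
  by rewrite (sub_actE sU) hV ?mulrA ?subvsP.
have nemb : ~ exists (U : {vspace P}) (hU : submod U), isom (pmod u) (sub_rmod hU).
  case=> U [sU' [i [hi i0 _]]].
  have /lker0_injP/(_ (vsproj (rideal u) u)) i0' := i0.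
  have [T0 _] := ind; apply: T0; apply: eq0_vspace => z _; apply: subvs_inj.
  suff u0 : u = 0 by rewrite -(valP z) (congr1 ( *%R^~ (vsval z)) u0) mul0r linear0.
  rewrite -[LHS](vsprojK u_in) i0' ?linear0 //; apply: subvs_inj.
  have -> : vsproj (rideal u) u = act (pmod u) u (vsproj (rideal u) u).
    by apply: subvs_inj; rewrite actE vsprojK // uu.
  by rewrite hi (sub_actE sU') abutment_J // linear0.
have [g hg gE] := extP _ ind (pmod_projective uu) nemb _ sU h hh.
exists (vsval (g g0)); first exact: valP.
have pg_in : act P (pth 0 k) g0 \in limg rho.
  apply/memv_imgP; exists E; rewrite ?memvf // rhoE vsprojK //.
  by rewrite -[k in eN k]add0n idem_pathr.
have := gE (vsproj (limg rho) (act P (pth 0 k) g0)).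
rewrite vsprojK // hg => /(congr1 vsval); rewrite actE => <-.
rewrite hE !vsprojK // (_ : act P (pth 0 k) g0 = rho E).
  by rewrite rhoK vsprojK // xk.
by rewrite rhoE vsprojK // -[k in eN k]add0n idem_pathr.
Qed.

(** In terms of the quiver: a path that enters the abutment from outside does so
    at its first vertex. *)
Lemma J_arrow k x : (k < n)%N -> J x -> exists2 y, J y & x * eN k.+1 = y * fN k.
Proof.
move=> kn Jx; have ww : w * w = w by apply: J_left_unit.
have [y wy yE] : exists2 y, w * y = y & x * eN k.+1 = y * pth 0 k.+1.
  apply: abutment_extend => //.
    by rewrite mulrA J_left_unit.
  by rewrite -mulrA idem_atM eqxx.
exists (y * pth 0 k); last by rewrite yE /= add0n mulrA.
by apply: Jr; rewrite -wy; apply: Jr.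
Qed.

(** * Splitting *)

Section Split.
Variable X : rmod A.
Local Notation mulJ := (mulJ X J).

(** A complement of [V] is built vertex by vertex along the linear quiver: it
    is a submodule because the idempotents of the abutment annihilate the ideal
    [J] from the left, so that only the arrows of the abutment act on it. *)
Lemma split_off (V : {vspace X}) : submod V ->
    (forall x a, J a -> act X a x \in V) ->
    (forall k, (k < n)%N -> (forall x, act X (eN k) x = 0) \/
       (act X (eN k.+1) @: V <= act X (fN k) @: V)%VS) ->
  exists Q : {vspace X},
    [/\ submod Q, (V + Q = fullv)%VS & (V :&: Q = 0)%VS].
Proof.
move=> sV VJ arrV.
pose N k := limg (act X (eN k)); pose U k := (act X (eN k) @: V)%VS.
have NE k x : x \in N k -> act X (eN k) x = x.
  by case/memv_imgP => y _ ->; rewrite act_act idem_atM eqxx.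
have UV k : (U k <= V)%VS by apply/subvP => _ /memv_imgP[v vV ->]; apply: sV.
have [|k kn|k kn|Q [UQ UQ0 fQ]] := @chain_complement _ _ n N U (fun k => act X (fN k)).
- by move=> k _; apply/limgS/subvf.
- apply/subvP => _ /memv_imgP[x _ ->]; apply/memv_imgP.
  by exists (act X (fN k) x); rewrite ?memvf // act_act idem_arrowr.
- case: (arrV k kn) => [N0|sub]; [left|right].
    by apply: eq0_vspace => x /NE <-.
  apply: subv_trans sub _; apply/subvP => _ /memv_imgP[v vV ->].
  apply/memv_imgP; exists (act X (eN k) v); rewrite ?memv_img //.
  by rewrite act_act idem_arrowl.
have QN k x : (k <= n)%N -> x \in Q k -> act X (eN k) x = x.
  by move=> kn xQ; apply: NE; rewrite -UQ // (subvP (addvSr _ _)).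
have Qpath k m x : (k + m <= n)%N -> x \in Q k -> act X (pth k m) x \in Q (k + m)%N.
  elim: m => [|m IHm] /= kn xQ; first by rewrite addn0 in kn *; rewrite QN.
  rewrite addnS in kn *; rewrite -act_act.
  by rewrite (subvP (fQ _ kn)) ?memv_img ?IHm // ltnW.
have idX x : x = act X w x + \sum_(k < n.+1) act X (eN k) x.
  rewrite -sum_lfunE -add_lfunE -linear_sum /= -sum_idem -linearD /= subrK.
  by rewrite act1 lfunE.
have J0 k a x : J a -> (k <= n)%N -> x \in Q k -> act X a x = 0.
  by move=> Ja kn xQ; rewrite -(QN k x) // act_act idem_J // act0.
exists (\sum_(k < n.+1) Q k)%VS; split.
- move=> a _ /memv_sumP[q qQ ->]; rewrite linear_sum; apply: memv_suml => k _.
  rewrite [X in X \in _]idX [X in X + _]act_act.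
  rewrite (J0 k) ?leq_ord ?qQ ?add0r //; last exact: Jl.
  apply: memv_suml => l _.
  have qk := qQ k isT; rewrite -(QN k (q k)) ?leq_ord // !act_act mulrA.
  have [c Jc] := Jgen a (leq_ord k) (leq_ord l).
  have := J0 k _ (q k) Jc (leq_ord k) qk.
  rewrite linearB add_lfunE opp_lfunE => /eqP; rewrite subr_eq0 => /eqP ->.
  case: leqP => [kl|_]; last by rewrite scaler0 act0 mem0v.
  rewrite linearZ scale_lfunE memvZ // (subvP (sumv_sup l _ (subvv _))) //.
  by rewrite -{2}(subnKC kl); apply: Qpath; rewrite ?subnKC ?leq_ord.
- apply: eq_fullv => x; rewrite [x]idX memvD //.
    by rewrite (subvP (addvSl _ _)) ?VJ.
  apply: memv_suml => k _.
  have : act X (eN k) x \in (U k + Q k)%VS by rewrite UQ ?leq_ord // memv_img ?memvf.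
  apply/subvP; apply: addvS => //; exact: (sumv_sup k).
apply: eq0_vspace => v /memv_capP[vV /memv_sumP[q qQ vE]].
have vk (k : 'I_n.+1) : q k = act X (eN k) v.
  rewrite vE linear_sum (bigD1 k) //= QN ?leq_ord ?qQ // big1 ?addr0 // => l lk.
  rewrite -(QN l (q l)) ?leq_ord ?qQ // act_act idem_atM.
  by rewrite (inj_eq val_inj) (negPf lk) act0.
rewrite vE big1 // => k _; apply/eqP; rewrite -memv0 -(UQ0 k) ?leq_ord //.
by rewrite memv_cap qQ // vk memv_img.
Qed.

(** Multiplication by the arrows maps [mulJ] onto its next component, by
    [J_arrow]: this is where the extension property of the abutment enters. *)
Lemma mulJ_split : exists Q : {vspace X},
  [/\ submod Q, (mulJ + Q = fullv)%VS & (mulJ :&: Q = 0)%VS].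
Proof.
apply: split_off => [|x a|k kn]; [exact: (mulJ_submod Jr)|exact: mem_mulJ|right].
have sub : (mulJ <= act X (eN k.+1) @^-1: (act X (fN k) @: mulJ))%VS.
  apply: span_of_sub => _ [x [a [Ja ->]]]; rewrite -memv_preim act_act.
  by have [b Jb ->] := J_arrow kn Ja; rewrite -act_act memv_img ?mem_mulJ.
apply/subvP => _ /memv_imgP[v vJ ->].
by move: (subvP sub v vJ); rewrite -memv_preim.
Qed.

End Split.

(** An indecomposable module [N] annihilated by [J] is generated by any nonzero
    vector [x] at the first vertex of its support: the submodule generated by
    [x] runs along a path, hence splits off. *)
Lemma foundationP (N : rmod A) : indecomposable N ->
  subquotient N P <-> (forall a, J a -> forall x, act N a x = 0).
Proof.
move=> iN; split=> [[U [hU [h [hh /limg_fullP hT]]]] a Ja x|NJ].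
  have [u <-] := hT x; rewrite -hh (_ : act _ a u = 0) ?linear0 //.
  by apply: subvs_inj; rewrite (sub_actE hU) abutment_J ?linear0.
have [N0 splitN] := iN.
have sumN x : x = \sum_(k < n.+1) act N (eN k) x.
  have /eqP := NJ _ Jw x; rewrite linearB /= add_lfunE opp_lfunE act1 lfunE /=.
  by rewrite subr_eq0 sum_idem linear_sum sum_lfunE => /eqP.
have [i [i_n [x0 ix0]] imin] : exists i, [/\ (i <= n)%N,
    exists x, act N (eN i) x <> 0 &
    forall k x, (k < i)%N -> act N (eN k) x = 0].
  have ex : exists k, `[< (k <= n)%N /\ exists x, act N (eN k) x <> 0 >].
    apply: contrapT => nex; apply: N0; apply: eq0_vspace => x _.
    rewrite [x]sumN big1 // => k _; apply: contrapT => kx; apply: nex.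
    by exists k; apply/asboolP; split; [apply: leq_ord | exists x].
  case: (ex_minnP ex) => i /asboolP[i_n ix] imin; exists i; split=> // k x ki.
  apply: contrapT => kx; move: (ki); rewrite ltnNge imin //.
  by apply/asboolP; split; [apply: leq_trans i_n; apply: ltnW | exists x].
have [x xi x_neq0] : exists2 x, act N (eN i) x = x & x <> 0.
  by exists (act N (eN i) x0); rewrite // act_act idem_atM eqxx.
have [h [hh hE]] := pmod_hom (eN i) x.
have sV : submod (limg h) by apply: limg_submod => //; apply: fullv_submod.
have memV a : act N a x \in limg h.
  have ea_in : eN i * a \in rideal (eN i).
    by rewrite rideal_mem ?mulrA ?idem_atM ?eqxx.
  apply/memv_imgP; exists (vsproj (rideal (eN i)) (eN i * a)).
    exact: memvf.
  by rewrite hE vsprojK // -act_act xi.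
have [|k kn|Q [sQ VQ VQ0]] := split_off sV.
- by move=> y a Ja; rewrite NJ ?mem0v.
- have [ki|ik] := ltnP k i; [by left=> y; apply: imin | right].
  apply/subvP => _ /memv_imgP[_ /memv_imgP[a _ ->] ->].
  rewrite hE -xi !act_act mulrA.
  have [c Jc] := Jgen (vsval a) i_n kn.
  rewrite leqW // subSn //= subnKC // in Jc.
  have /eqP := NJ _ Jc x; rewrite linearB /= add_lfunE opp_lfunE subr_eq0.
  move/eqP->; rewrite linearZ scale_lfunE memvZ // -act_act memv_img ?memV //.
have [V0|Q0] := splitN _ _ sV sQ VQ VQ0.
  by case: x_neq0; apply/eqP; rewrite -memv0 -V0 -xi memV.
have [g0 [_ g00]] := abutment_generator.
have [rho [hrho rho0 _]] := abutment_embed i_n g00.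
have rhoK := lker0_lfunK (introT eqP rho0).
have sU : submod (limg rho) by apply: limg_submod => //; apply: fullv_submod.
have [|h' h'E] := @linear_lfun _ (sub_rmod sU) N
   (fun z => h ((rho^-1)%VF (vsval z))).
  by move=> c z z'; rewrite !linearP.
exists (limg rho), sU, h'; split=> [a z|].
  rewrite !h'E (sub_actE sU) -hh.
  by have /memv_imgP[t _ ->] := subvsP z; rewrite -hrho !rhoK.
apply/limg_fullP => y.
have : y \in limg h by have := memvf y; rewrite -VQ Q0 addv0.
case/memv_imgP => t _ ->; exists (vsproj (limg rho) (rho t)).
by rewrite h'E vsprojK ?rhoK // memv_img ?memvf.
Qed.

End Abutment.

(** * Collapse maps *)

Section Collapse.
Variables (K : fieldType) (A : falgType K) (n : nat).
Variables (e : 'I_n.+1 -> A) (f : 'I_n -> A).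
Variable F : A -> 'M[K]_n.+1.
Hypotheses (F_lin : linear F) (FM : forall a b, F (a * b) = F a *m F b).
Hypotheses (F_outer : F (1 - \sum_i e i) = 0)
  (F_idem : forall i, F (e i) = delta_mx i i)
  (F_arrow : forall i : 'I_n,
     F (f i) = delta_mx (widen_ord (leqnSn n) i) (lift ord0 i))
  (F_triangular : forall a (i j : 'I_n.+1), (j < i)%N -> F a i j = 0).
Local Notation pth := (path_at e f).

Let F' : {linear A -> 'M[K]_n.+1} :=
  HB.pack F (GRing.isLinear.Build K A 'M[K]_n.+1 _ F F_lin).

Lemma F_path k m : (k + m <= n)%N ->
  F (pth k m) = delta_mx (inord k) (inord (k + m)).
Proof.
elim: m => [|m IHm] /=.
  rewrite addn0 => kn; rewrite -F_idem -(idem_at_ord e) inordK //.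
rewrite addnS => kmn; rewrite FM IHm ?(ltnW kmn) //.
rewrite /arrow_at (insubT (fun k => k < n)%N kmn) /= F_arrow.
set i := widen_ord _ _; set j := lift _ _.
have -> : inord (k + m) = i by apply: val_inj; rewrite /= inordK // ltnS ltnW.
rewrite mul_delta_mx; congr (delta_mx _ _); apply: val_inj.
by rewrite /= /bump leq0n add1n inordK.
Qed.

(** The corner [e_k A e_l] is mapped into the line spanned by one matrix unit,
    which is the image of the path from [k] to [l] if [k <= l]; otherwise the image
    of the corner is 0, because [F] takes triangular values. *)
Lemma collapse_kernelP : collapse_kernel e f (fun a => F a = 0).
Proof.
split=> [a x Fx|a x Fx||/=|a k l kn ln] //.
- by rewrite FM Fx mulmx0.
- by rewrite FM Fx mul0mx.
- rewrite F_path // => /matrixP/(_ (inord 0) (inord (0 + n))) /eqP.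
  by rewrite !mxE !eqxx oner_eq0.
pose i : 'I_n.+1 := inord k; pose j : 'I_n.+1 := inord l.
have iE : idem_at e k = e i by rewrite -(idem_at_ord e) inordK.
have jE : idem_at e l = e j by rewrite -(idem_at_ord e) inordK.
have sandwich : F (idem_at e k * a * idem_at e l) = F a i j *: delta_mx i j.
  rewrite iE jE !FM !F_idem; apply/matrixP => s t; rewrite !mxE (bigD1 j) //=.
  rewrite big1 ?addr0 => [|u uj]; last by rewrite !mxE (negPf uj) mulr0.
  rewrite !mxE (bigD1 i) //= big1 ?addr0 => [|u ui]; last first.
    by rewrite !mxE (negPf ui) andbF mul0r.
  rewrite !mxE !eqxx andbT /=; case: (s == i); rewrite ?mul0r ?mulr0 ?mul1r //=.
exists (F a i j); rewrite -[F _]/(F' _) linearB linearZ /= sandwich.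
case: leqP => [kl|lk]; first by rewrite F_path ?subnKC // subrr.
by rewrite F_triangular ?scale0r ?subrr // !inordK.
Qed.

Lemma collapse_surj (M : 'M[K]_n.+1) :
  (forall i j : 'I_n.+1, (j < i)%N -> M i j = 0) -> exists a, F a = M.
Proof.
move=> Mtri; exists (\sum_i \sum_j M i j *: pth i (j - i)).
rewrite -[F _]/(F' _) linear_sum [RHS]matrix_sum_delta; apply: eq_bigr => i _.
rewrite linear_sum; apply: eq_bigr => j _; rewrite linearZ /=.
have [ij|ji] := leqP i j; last by rewrite Mtri ?scale0r.
by rewrite F_path ?subnKC // ?inord_val // -ltnS.
Qed.

End Collapse.

Section PathAlgebraMap.
Variables (K : fieldType) (A : falgType K) (n : nat).

Lemma KA_triangular (x : KA K n) (i j : 'I_n.+1) :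
  (j < i)%N -> (vsval x : 'M[K]_n.+1) i j = 0.
Proof.
move=> ji; have /memv_sumP[d dP ->] := subvsP x.
rewrite summxE big1 // => -[s t] /= st; have /vlineP[c ->] := dP (s, t) st.
rewrite !mxE; case: eqP => [is_|_] /=; rewrite ?mulr0 //.
case: eqP => [jt|_]; rewrite ?mulr0 //.
by move: ji; rewrite is_ jt ltnNge st.
Qed.

Variables (e : 'I_n.+1 -> A) (f : 'I_n -> A).
Variables (F : {lrmorphism A -> KA K n}).
Hypothesis hF : collapse_map e f F.

Definition collapse_mx (a : A) : 'M[K]_n.+1 := vsval (F a).

Fact collapse_mx_linear : linear collapse_mx.
Proof. by move=> k a b; rewrite /collapse_mx !linearP. Qed.

Fact collapse_mxM a b : collapse_mx (a * b) = collapse_mx a *m collapse_mx b.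
Proof. by rewrite /collapse_mx rmorphM. Qed.

Fact collapse_mx_eq0 a : collapse_mx a = 0 <-> F a = 0.
Proof.
by split=> [Fa|Fa]; [apply: subvs_inj; rewrite linear0 | rewrite /collapse_mx Fa linear0].
Qed.

Fact collapse_mx_outer : collapse_mx (1 - \sum_i e i) = 0.
Proof. by apply/collapse_mx_eq0; have [] := hF. Qed.

Fact collapse_mx_idem i : collapse_mx (e i) = delta_mx i i.
Proof. by have [_ E _] := hF; rewrite /collapse_mx E vsprojK // KA_path. Qed.

Fact collapse_mx_arrow i :
  collapse_mx (f i) = delta_mx (widen_ord (leqnSn n) i) (lift ord0 i).
Proof.
by have [_ _ E] := hF; rewrite /collapse_mx E vsprojK // KA_path.
Qed.

Lemma collapse_map_surj c : exists a, F a = c.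
Proof.
have [a Fa] := collapse_surj collapse_mx_linear collapse_mxM
  collapse_mx_idem collapse_mx_arrow (@KA_triangular c).
by exists a; apply: subvs_inj.
Qed.

End PathAlgebraMap.

(** * Duality *)

Section Duality.
Variables (K : fieldType) (A : falgType K).
Implicit Types (M N X : rmod A).

Lemma dual_transpose M (T : 'End(dual M)) (t : 'End(M)) :
    (forall (xi : 'Hom(M, K^o)) v, xi (t v) = (T xi : 'Hom(M, K^o)) v) ->
  @is_hom K (opp_alg A) (dual M) (dual M) T -> is_hom t.
Proof.
move=> tT hT a v; apply: functional_sep => xi.
rewrite tT -[RHS]dual_actE tT -[dual_act _ _]/(act (dual M) (a : opp_alg A)).
by rewrite hT dual_actE.
Qed.

(** Idempotent endomorphisms of the dual are transposes of idempotent
    endomorphisms. *)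
Lemma dual_indecomposable N : indecomposable N -> indecomposable (dual N).
Proof.
move=> iN; apply: idem_indecomposable => [D0|T hT TT].
  have [N0 _] := iN; apply: N0; apply: eq0_vspace => x _.
  apply: functional_sep => xi; suff -> : xi = 0 by rewrite !zero_lfunE.
  by apply/eqP; rewrite -memv0 -D0 memvf.
have [t tT] := transpose_ex (T : 'End('Hom(N, K^o))).
have tt x : t (t x) = t x.
  by apply: functional_sep => xi; rewrite !tT -[in RHS]TT.
have [t0|t1] := indecomposable_idem iN (dual_transpose tT hT) tt; [left|right].
  apply/lfunP => xi; apply/lfunP => v.
  by rewrite -[LHS]tT t0 !zero_lfunE linear0.
by apply/lfunP => xi; apply/lfunP => v; rewrite -[LHS]tT t1 !lfunE.
Qed.

(** A submodule [U] of [D M] mapping onto [D N] embeds [N] into the quotient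
    [D U] of [M]; the preimage of [N] in [M] is the submodule that maps onto
    [N]. *)
Lemma dual_subquotient N M : subquotient (dual N) (dual M) -> subquotient N M.
Proof.
case=> U [hU [s [hs /limg_fullP sT]]].
(* [rel x m] says that [x] and [m] have the same image in [D U]. *)
pose rel (x : M) (m : N) := forall u : subvs_of U,
  (vsval u : 'Hom(M, K^o)) x = (s u : 'Hom(N, K^o)) m.
have rel_fun x m m' : rel x m -> rel x m' -> m = m'.
  move=> r r'; apply: functional_sep => xi; have [u <-] := sT xi.
  exact: etrans (esym (r u)) (r' u).
have relD k x x' m m' : rel x m -> rel x' m' -> rel (k *: x + x') (k *: m + m').
  by move=> r r' u; rewrite !linearP /= r r'.
have rel0 : rel 0 0 by move=> u; rewrite !linear0.
have rel_act a x m : rel x m -> rel (act M a x) (act N a m).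
  move=> r u; rewrite -[LHS]dual_actE -[RHS]dual_actE.
  have := r (act (sub_rmod hU) (a : opp_alg A) u).
  by rewrite hs (sub_actE hU).
pose U' : {vspace M} := span_of (fun x => exists m, rel x m).
have U'P x : x \in U' <-> exists m, rel x m.
  apply: span_ofP; first by exists 0.
  by move=> k u v [m r] [m' r']; exists (k *: m + m'); apply: relD.
have U'r (x : subvs_of U') : exists m, rel (vsval x) m by apply/U'P/subvsP.
have sU' : submod U'.
  by move=> a u /U'P[m r]; apply/U'P; exists (act N a m); apply: rel_act.
pose h x := projT1 (cid (U'r x)).
have hE x : rel (vsval x) (h x) by rewrite /h; case: cid.
have [|h' h'E] := @linear_lfun _ (sub_rmod sU') N h.
  move=> k x y; apply: rel_fun (hE _) _; rewrite linearP /=.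
  by apply: relD; apply: hE.
exists U', sU', h'; split=> [a x|].
  by rewrite !h'E; apply: rel_fun (hE _) _; rewrite (sub_actE sU'); apply: rel_act.
apply/limg_fullP => m.
have [|l lE] := @linear_lfun _ 'Hom(M, K^o) K^o (fun xi =>
    (s (vsproj U (projv U xi)) : 'Hom(N, K^o)) m).
  by move=> k u v; rewrite !linearP add_lfunE scale_lfunE.
have [x xE] := bidual l.
have xm : rel x m by move=> u; rewrite xE lE projv_id ?subvsP // vsvalK.
have x_in : x \in U' by apply/U'P; exists m.
exists (vsproj U' x); rewrite h'E.
by apply: rel_fun (hE _) _; rewrite vsprojK.
Qed.

End Duality.

(** * The kernels of the two collapse maps *)

Lemma left_abutment_facts (K : fieldType) (A : falgType K) (P : rmod A) (n : nat)
    (e : 'I_n.+1 -> A) (f : 'I_n -> A) (F : {lrmorphism A -> KA K n}) :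
    left_abutment P -> realization P e f -> collapse_map e f F ->
  [/\ exists2 w, F w = 0 & forall x, F x = 0 -> w * x = x,
      forall X : rmod A, exists Q : {vspace X}, [/\ submod Q,
        (mulJ X (in_ker F) + Q = fullv)%VS
      & (mulJ X (in_ker F) :&: Q = 0)%VS]
    & forall N, indecomposable N -> subquotient N P <-> annihilated F N].
Proof.
move=> abutP realP hF.
have kerJ := collapse_kernelP (collapse_mx_linear F) (collapse_mxM F)
  (collapse_mx_outer hF) (collapse_mx_idem hF) (collapse_mx_arrow hF)
  (fun a => @KA_triangular _ _ (F a)).
have JE : (fun a => collapse_mx F a = 0) = (fun a => F a = 0).
  by apply: funext => a; apply/propext/collapse_mx_eq0.
rewrite JE in kerJ; split=> [|X|N iN].
- exists (1 - \sum_i e i) => [|x]; first exact: kernel_outer kerJ.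
  exact: J_left_unit abutP realP _ kerJ x.
- exact: mulJ_split abutP realP _ kerJ X.
exact: foundationP abutP realP _ kerJ _ iN.
Qed.

Section RightAbutment.
Variables (K : fieldType) (B : falgType K) (I : rmod B) (n : nat).
Variables (eps : 'I_n.+1 -> B) (g : 'I_n -> B) (G : {lrmorphism B -> KA K n}).
Hypotheses (abutI : right_abutment I) (realI : corealization I eps g).
Hypothesis hG : collapse_map eps g G.

(** The reflection in the antidiagonal reverses products and preserves upper
    triangular matrices: it identifies [KA_h] with its opposite algebra, reversing
    the numbering of the vertices as a corealization does. *)
Definition flip_mx (M : 'M[K]_n.+1) : 'M[K]_n.+1 :=
  \matrix_(i, j) M (rev_ord j) (rev_ord i).

Lemma flip_delta i j : flip_mx (delta_mx i j) = delta_mx (rev_ord j) (rev_ord i).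
Proof.
apply/matrixP => s t; rewrite !mxE.
rewrite -(inj_eq rev_ord_inj (rev_ord t)) -(inj_eq rev_ord_inj (rev_ord s)).
by rewrite !rev_ordK andbC.
Qed.

Definition collapse_op (b : opp_alg B) : 'M[K]_n.+1 := flip_mx (collapse_mx G b).

Fact collapse_op_linear : linear collapse_op.
Proof.
move=> k a b; apply/matrixP => i j; rewrite /collapse_op !mxE.
by rewrite (collapse_mx_linear G k (a : B) (b : B)) !mxE.
Qed.

Fact collapse_opM a b : collapse_op (a * b) = collapse_op a *m collapse_op b.
Proof.
apply/matrixP => i j; rewrite /collapse_op opp_algM collapse_mxM !mxE.
rewrite (reindex_inj rev_ord_inj) /=; apply: eq_bigr => k _.
by rewrite !mxE mulrC.
Qed.

Fact flip_mx_eq0 M : flip_mx M = 0 <-> M = 0.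
Proof.
split=> [M0|->]; apply/matrixP => i j; last by rewrite !mxE.
have /matrixP/(_ (rev_ord j) (rev_ord i)) := M0.
by rewrite !mxE !rev_ordK.
Qed.

Lemma collapse_op_kernel :
  @collapse_kernel K (opp_alg B) n (fun i => eps (rev_ord i))
    (fun i => g (rev_ord i)) (fun b => G b = 0).
Proof.
have JE : (fun b => collapse_op b = 0) = (fun b => G b = 0).
  apply: funext => b; apply/propext; rewrite -collapse_mx_eq0.
  exact: flip_mx_eq0.
rewrite -JE; apply: collapse_kernelP.
- exact: collapse_op_linear.
- exact: collapse_opM.
- apply/flip_mx_eq0; have := collapse_mx_outer hG.
  by rewrite (reindex_inj rev_ord_inj).
- by move=> i; rewrite /collapse_op (collapse_mx_idem hG) flip_delta rev_ordK.
- move=> i; rewrite /collapse_op (collapse_mx_arrow hG) flip_delta.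
  congr (delta_mx _ _); apply: val_inj; rewrite /= /bump ?leq0n.
    by rewrite -[(true + _)%N]/(_.+1) subSS subnSK // subKn // ltnW.
  by rewrite subSS subKn.
- by move=> a i j ji; rewrite mxE KA_triangular //= ltn_sub2lE ?ltn_ord.
Qed.

(** The summand [(D Y) J] of the dual of [Y] has for annihilator in [Y] the
    submodule of the elements killed by [J]; the transpose of the complementary
    projector is a projector onto it. *)
Lemma right_abutment_facts :
  [/\ exists2 w, G w = 0 & forall x, G x = 0 -> x * w = x,
      forall Y : rmod B, exists t : 'End(Y), [/\ is_hom t,
        forall y, (forall b, G b = 0 -> act Y b y = 0) -> t y = y
      & forall y b, G b = 0 -> act Y b (t y) = 0]
    & forall N, indecomposable N -> subquotient N I <-> annihilated G N].
Proof.
have [_ _ abutD] := abutI; have kerJ := collapse_op_kernel.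
split=> [|Y|N iN].
- exists (1 - \sum_i eps (rev_ord i) : opp_alg B) => [|x].
    exact: kernel_outer kerJ.
  exact: J_left_unit abutD realI _ kerJ x.
- have [Q [sQ UQ UQ0]] := mulJ_split abutD realI kerJ (dual Y).
  have sU := mulJ_submod (X := dual Y) (kernel_right_ideal kerJ).
  have [p [hp pU pQ pM]] := complement_projector sU sQ UQ UQ0.
  have [t tT] := transpose_ex (\1 - p : 'End('Hom(Y, K^o)))%VF.
  have hT : @is_hom _ _ (dual Y) (dual Y) (\1 - p)%VF.
    by apply: is_homB => //; apply: is_hom_id.
  have ht := dual_transpose tT hT.
  have tE (xi : 'Hom(Y, K^o)) y : xi (t y) = xi y - (p xi : 'Hom(Y, K^o)) y.
    rewrite tT add_lfunE opp_lfunE lfunE /=.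
    by congr (_ + _); [rewrite lfunE | rewrite opp_lfunE].
  exists t; split=> // [y yJ|y b Gb]; apply: functional_sep => xi.
    have [|ev evE] := @linear_lfun _ (dual Y) K^o (fun eta : 'Hom(Y, K^o) => eta y).
      by move=> k u v; rewrite add_lfunE scale_lfunE.
    have evJ : (mulJ (dual Y) (fun b : opp_alg B => G b = 0%R) <= lker ev)%VS.
      apply: span_of_sub => _ [eta [b [Gb ->]]].
      by rewrite memv_ker evE [X in X == _]dual_actE yJ ?linear0.
    have /(subvP evJ) := pM xi; rewrite memv_ker evE tE => /eqP->.
    by rewrite subr0.
  rewrite -ht tE linear0 -!dual_actE.
  have /pU := mem_mulJ (xi : dual Y) (Gb : in_ker G b); rewrite hp => pJ.
  by rewrite [X in _ - X](_ : _ = dual_act Y b xi y) ?subrr // -[in RHS]pJ.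
split=> [[U [hU [h [hh /limg_fullP hT]]]] b Gb x|NJ].
  have [u <-] := hT x; rewrite -hh (_ : act _ b u = 0) ?linear0 //.
  apply: subvs_inj; rewrite (sub_actE hU) linear0.
  apply: functional_sep => xi; rewrite -[LHS]dual_actE linear0.
  have := abutment_J abutD realI kerJ (xi : dual I) Gb.
  by move=> E; rewrite [dual_act _ _ _]E zero_lfunE.
apply: dual_subquotient; apply/(foundationP abutD realI kerJ).
  exact: dual_indecomposable.
by move=> b Gb x; apply/lfunP => m; rewrite [LHS]dual_actE NJ // zero_lfunE linear0.
Qed.

End RightAbutment.

(** * Modules over the gluing *)

Section Pullback.
Variables (K : fieldType) (A B C L : falgType K).
Variables (F : {lrmorphism A -> C}) (G : {lrmorphism B -> C}).
Variables (phi : {lrmorphism L -> A}) (psi : {lrmorphism L -> B}).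
Hypotheses (square : forall l, F (phi l) = G (psi l))
  (pull : forall a b, F a = G b -> exists l, phi l = a /\ psi l = b)
  (phi_psi_inj : forall l, phi l = 0 -> psi l = 0 -> l = 0).
Hypotheses (F_surj : forall c, exists a, F a = c)
  (G_surj : forall c, exists b, G b = c).
(* The abutments enter only through the units and the splittings below. *)
Hypothesis F_unit : exists2 w, F w = 0 & forall x, F x = 0 -> w * x = x.
Hypothesis G_unit : exists2 w, G w = 0 & forall x, G x = 0 -> x * w = x.
Hypothesis F_split : forall X : rmod A, exists Q : {vspace X},
  [/\ submod Q, (mulJ X (in_ker F) + Q = fullv)%VS
    & (mulJ X (in_ker F) :&: Q = 0)%VS].
Hypothesis G_split : forall Y : rmod B, exists t : 'End(Y), [/\ is_hom t,
    forall y, (forall b, G b = 0 -> act Y b y = 0) -> t y = y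
  & forall y b, G b = 0 -> act Y b (t y) = 0].

Lemma phi_surj a : exists l, phi l = a.
Proof.
have [b Gb] := G_surj (F a); have [|l [<- _]] := @pull a b; first by rewrite Gb.
by exists l.
Qed.

Lemma psi_surj b : exists l, psi l = b.
Proof.
have [a Fa] := F_surj (G b); have [l [_ lb]] := pull Fa. by exists l.
Qed.

Lemma lift_kerF a : F a = 0 -> exists2 l, phi l = a & psi l = 0.
Proof.
by move=> Fa; have [|l [<- l0]] := @pull a 0; [rewrite Fa linear0 | exists l].
Qed.

Lemma lift_kerG b : G b = 0 -> exists2 l, psi l = b & phi l = 0.
Proof.
by move=> Gb; have [|l [l0 <-]] := @pull 0 b; [rewrite Gb linear0 | exists l].
Qed.

Lemma kerM0 l m : phi l = 0 -> psi m = 0 -> l * m = 0 /\ m * l = 0.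
Proof.
by move=> l0 m0; split; apply: phi_psi_inj; rewrite rmorphM /= ?l0 ?m0 ?mul0r ?mulr0.
Qed.

(** [ker psi] is a copy of the kernel of [F]; in particular it has a left
    unit, and [ker phi] has a right unit. These idempotents stand for the vertices
    outside of the two abutments. *)
Lemma ker_psi_unit : exists2 w, psi w = 0 & forall l, psi l = 0 -> w * l = l.
Proof.
have [a Fa aU] := F_unit; have [w wa w0] := lift_kerF Fa; exists w => // l l0.
apply/eqP; rewrite -subr_eq0; apply/eqP; apply: phi_psi_inj.
  by rewrite rmorphB rmorphM /= wa aU ?subrr // square l0 linear0.
by rewrite rmorphB rmorphM /= w0 l0 mul0r subrr.
Qed.

Lemma ker_phi_unit : exists2 w, phi w = 0 & forall l, phi l = 0 -> l * w = l.
Proof.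
have [b Gb bU] := G_unit; have [w wb w0] := lift_kerG Gb; exists w => // l l0.
apply/eqP; rewrite -subr_eq0; apply/eqP; apply: phi_psi_inj.
  by rewrite rmorphB rmorphM /= w0 l0 mul0r subrr.
by rewrite rmorphB rmorphM /= wb bU ?subrr // -square l0 linear0.
Qed.

Section Summands.
Variable Z : rmod L.

Lemma mul_ker_psi_annihilated u l :
  u \in mulJ Z (in_ker psi) -> phi l = 0 -> act Z l u = 0.
Proof.
move=> uU l0; have : (mulJ Z (in_ker psi) <= lker (act Z l))%VS.
  apply: span_of_sub => _ [x [m [m0 ->]]].
  by rewrite memv_ker act_act; have [_ ->] := kerM0 l0 m0; rewrite act0.
by move/subvP/(_ u uU); rewrite memv_ker => /eqP.
Qed.

(** The split submodule [X (ker F)] of the [A]-module [X = Z / Z (ker phi)]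
    is the isomorphic image of [Z (ker psi)]; pull back its complement. *)
Lemma mul_ker_psi_split : exists Q : {vspace Z}, [/\ submod Q,
  (mulJ Z (in_ker psi) + Q = fullv)%VS & (mulJ Z (in_ker psi) :&: Q = 0)%VS].
Proof.
pose N := mulJ Z (in_ker phi); pose U := mulJ Z (in_ker psi).
have sN : submod N by exact: mulJ_ker_submod.
have hq := is_hom_qproj sN.
have annN : annihilated phi (quot_rmod sN).
  move=> l l0 q; rewrite -[q]qprojK -hq; apply/eqP.
  by rewrite qproj_eq0 mem_mulJ.
pose X := desc phi_surj annN.
have actX l z : act X (phi l) (qproj N z) = qproj N (act Z l z).
  by rewrite hq; apply: (desc_actE annN).
have UX u : u \in U -> qproj N u \in mulJ X (in_ker F).
  move=> uU; have : (U <= qproj N @^-1: mulJ X (in_ker F))%VS.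
    apply: span_of_sub => _ [x [l [l0 ->]]]; rewrite -memv_preim -actX.
    apply: (@mem_mulJ _ _ X (in_ker F)); rewrite /in_ker square l0 linear0 //.
  by move/subvP/(_ u uU); rewrite -memv_preim.
have XU : (mulJ X (in_ker F) <= qproj N @: U)%VS.
  apply: span_of_sub => _ [x [a [Fa ->]]]; have [l <- l0] := lift_kerF Fa.
  by rewrite -[x]qprojK actX memv_img // mem_mulJ.
have [Q [sQ XQ XQ0]] := F_split X.
exists (qproj N @^-1: Q)%VS; split.
- move=> l z; rewrite -!memv_preim => zQ; have := sQ (phi l) _ zQ.
  by rewrite actX.
- apply: eq_fullv => z.
  have : qproj N z \in (mulJ X (in_ker F) + Q)%VS by rewrite XQ memvf.
  case/memv_addP => _ /(subvP XU)/memv_imgP[u uU ->] [q qQ zE].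
  rewrite -[z](subrK u) addrC memv_add // -memv_preim linearB /= zE.
  by rewrite addrC addKr.
apply: eq0_vspace => u /memv_capP[uU]; rewrite -memv_preim => uQ.
have : qproj N u \in (mulJ X (in_ker F) :&: Q)%VS by rewrite memv_cap UX.
rewrite XQ0 memv0 qproj_eq0 => uN.
(* A right unit of [ker phi] fixes [Z (ker phi)] and kills [Z (ker psi)]. *)
have [w w0 wU] := ker_phi_unit.
have : (N <= lker (act Z w - \1)%VF)%VS.
  apply: span_of_sub => _ [x [l [l0 ->]]].
  by rewrite memv_ker add_lfunE opp_lfunE lfunE /= act_act wU ?subrr.
move/subvP/(_ u uN); rewrite memv_ker add_lfunE opp_lfunE lfunE /=.
by rewrite mul_ker_psi_annihilated // sub0r oppr_eq0 => /eqP.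
Qed.

Lemma psi_quotient_summand : exists (Y : rmod B)
    (pr : 'Hom(Z, res psi Y)) (inc : 'Hom(res psi Y, Z)),
  [/\ is_hom pr, is_hom inc & forall z, z - inc (pr z) \in mulJ Z (in_ker psi)].
Proof.
have [Q [sQ UQ UQ0]] := mul_ker_psi_split.
set U := mulJ Z _ in UQ UQ0 *.
have sU : submod U by exact: mulJ_ker_submod.
have [p [hp pU pQ pM]] := complement_projector sU sQ UQ UQ0.
have hq := is_hom_qproj sU.
have annU : annihilated psi (quot_rmod sU).
  move=> l l0 q; rewrite -[q]qprojK -hq; apply/eqP.
  by rewrite qproj_eq0 mem_mulJ.
pose Y := desc psi_surj annU.
have actY l q : act (res psi Y) l q = act (quot_rmod sU) l q
    by apply: (desc_actE annU).
(* [1 - p] vanishes on [U], so it factors through the quotient. *)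
have [|inc incE] := @linear_lfun _ (res psi Y) Z
  (fun q : quot U => vsval q - p (vsval q)).
  by move=> k u v; rewrite !linearP /= addrACA -scalerDr.
have incq z : inc (qproj U z) = z - p z.
  pose d := vsval (qproj U z) - z.
  have dU : d \in U by rewrite -qproj_eq0 linearB /= qprojK subrr.
  rewrite incE (_ : vsval _ = z + d); last by rewrite addrC subrK.
  by rewrite linearD /= (pU d dU) opprD addrACA subrr addr0.
exists Y, (qproj U), inc; split=> [l z|l q|z].
- by rewrite actY -hq.
- rewrite actY -[q]qprojK -hq !incq hp -linearB //.
by rewrite incq subKr pM.
Qed.

(** Let [Z1] be the largest submodule of [Z] that is a [B]-module. In [Z1] the
    elements annihilated by [ker phi] split off, and the complement in [Z1] is also a
    complement in [Z], because [z = z w + z (1 - w)] for a left unit [w] of [ker psi],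
    where [z w] is annihilated by [ker phi] and [z (1 - w)] lies in [Z1]. *)
Lemma phi_sub_summand : exists (X : rmod A)
    (pr : 'Hom(Z, res phi X)) (inc : 'Hom(res phi X, Z)),
  [/\ is_hom pr, is_hom inc &
    forall z, (forall l, phi l = 0 -> act Z l z = 0) -> inc (pr z) = z].
Proof.
pose Z1 : {vspace Z} := span_of (fun z => forall l, psi l = 0 -> act Z l z = 0).
pose Z0 : {vspace Z} := span_of (fun z => forall l, phi l = 0 -> act Z l z = 0).
have Z1P z : z \in Z1 <-> forall l, psi l = 0 -> act Z l z = 0.
  apply: span_ofP => [l _|k u v hu hv l l0]; first by rewrite linear0.
  by rewrite linearP /= hu // hv // scaler0 addr0.
have Z0P z : z \in Z0 <-> forall l, phi l = 0 -> act Z l z = 0.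
  apply: span_ofP => [l _|k u v hu hv l l0]; first by rewrite linear0.
  by rewrite linearP /= hu // hv // scaler0 addr0.
have sZ1 : submod Z1.
  move=> l z /Z1P zZ; apply/Z1P => m m0; rewrite act_act zZ //.
  by rewrite rmorphM /= m0 mulr0.
have sZ0 : submod Z0.
  move=> l z /Z0P zZ; apply/Z0P => m m0; rewrite act_act zZ //.
  by rewrite rmorphM /= m0 mulr0.
have ann1 : annihilated psi (sub_rmod sZ1).
  move=> l l0 z; apply: subvs_inj; rewrite (sub_actE sZ1) linear0.
  by have /Z1P -> := subvsP z.
pose Y := desc psi_surj ann1; have [t [ht tfix tann]] := G_split Y.
have actY l (y : subvs_of Z1) : vsval (act Y (psi l) y) = act Z l (vsval y).
  by rewrite -(sub_actE sZ1); congr vsval; apply: (desc_actE ann1).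
have Y0 (y : subvs_of Z1) :
  (forall l, phi l = 0 -> act Z l (vsval y) = 0) <->
  (forall b, G b = 0 -> act Y b y = 0).
  split=> [yann b Gb|yann l l0].
    have [l <- l0] := lift_kerG Gb; apply: subvs_inj.
    by rewrite actY yann // linear0.
  by rewrite -actY yann ?linear0 // -square l0 linear0.
pose val1 : 'Hom(Y, Z) := linfun (vsval : subvs_of Z1 -> Z).
have val1E y : val1 y = vsval y by rewrite lfunE.
have [w w0 wU] := ker_psi_unit.
have [||||p [hp p0 _ pZ]] := @complement_projector _ _ Z Z0 (val1 @: lker t)%VS.
- exact: sZ0.
- move=> l _ /memv_imgP[y ty ->]; apply/memv_imgP; exists (act Y (psi l) y).
    by move: ty; rewrite !memv_ker ht => /eqP->; rewrite linear0.
  by rewrite !val1E actY.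
- apply: eq_fullv => z.
  have zw : act Z w z \in Z0.
    by apply/Z0P => l l0; rewrite act_act; have [_ ->] := kerM0 l0 w0; rewrite act0.
  have zw' : z - act Z w z \in Z1.
    by apply/Z1P => l l0; rewrite linearB /= act_act wU // subrr.
  pose y : Y := vsproj Z1 (z - act Z w z).
  have ty0 : vsval (t y) \in Z0 by apply/Z0P/Y0/tann.
  have -> : z = (act Z w z + vsval (t y)) + val1 (y - t y).
    by rewrite val1E linearB /= vsprojK // -addrA [vsval _ + _]addrC subrK addrC subrK.
  rewrite memv_add ?memvD // memv_img // memv_ker linearB /=.
  by rewrite [t (t y)]tfix ?subrr //; apply: tann.
- apply: eq0_vspace => _ /memv_capP[/[swap] /memv_imgP[y ty ->]].
  rewrite val1E => /Z0P/Y0/tfix yE.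
  by move: ty; rewrite memv_ker yE => /eqP->; rewrite linear0.
have ann0 : annihilated phi (sub_rmod sZ0).
  move=> l l0 z; apply: subvs_inj; rewrite (sub_actE sZ0) linear0.
  by have /Z0P -> := subvsP z.
pose X := desc phi_surj ann0.
have actX l x : act (res phi X) l x = act (sub_rmod sZ0) l x
    by apply: (desc_actE ann0).
have [|pr prE] := @linear_lfun _ Z (res phi X) (fun z => vsproj Z0 (p z)).
  by move=> k u v; rewrite !linearP.
pose inc : 'Hom(res phi X, Z) := linfun (vsval : subvs_of Z0 -> Z).
have incE x : inc x = vsval x by rewrite lfunE.
exists X, pr, inc; split=> [l z|l x|z /Z0P zZ].
- by rewrite actX !prE; apply: subvs_inj; rewrite (sub_actE sZ0) !vsprojK // hp.
- by rewrite actX !incE (sub_actE sZ0).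
by rewrite incE prE vsprojK p0.
Qed.

End Summands.

Lemma annihilated_res_phi (X : rmod A) :
  annihilated psi (res phi X) <-> annihilated F X.
Proof.
split=> annX => [a Fa|l l0] x.
  by have [l <- l0] := lift_kerF Fa; apply: annX.
by apply: annX; rewrite square l0 linear0.
Qed.

Lemma annihilated_res_psi (Y : rmod B) :
  annihilated phi (res psi Y) <-> annihilated G Y.
Proof.
split=> annY => [b Gb|l l0] y.
  by have [l <- l0] := lift_kerG Gb; apply: annY.
by apply: annY; rewrite -square l0 linear0.
Qed.

(** The summand [M (ker psi)] of an indecomposable module is trivial. *)
Lemma indecomposable_annihilated (M : rmod L) : indecomposable M ->
  annihilated psi M \/ mulJ M (in_ker psi) = fullv.
Proof.
move=> [_ splitM]; have [Q [sQ UQ UQ0]] := mul_ker_psi_split M.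
have sU : submod (mulJ M (in_ker psi)) by exact: mulJ_ker_submod.
have [U0|Q0] := splitM _ _ sU sQ UQ UQ0; [left|right].
  by move=> l l0 x; apply/eqP; rewrite -memv0 -U0 mem_mulJ.
by rewrite -UQ Q0 addv0.
Qed.

Lemma indecomposable_supported (M : rmod L) : indecomposable M ->
  annihilated phi M \/ annihilated psi M.
Proof.
case/indecomposable_annihilated=> [|U]; [by right|left] => l l0 x.
by apply: mul_ker_psi_annihilated => //; rewrite U memvf.
Qed.

(** A path of radical maps between [A]-modules factors through the largest
    [A]-submodule of the middle term, which is a direct summand. *)
Lemma rad2_phi (X X' : rmod A) : @rad2 K L (res phi X) (res phi X') = rad2 X X'.
Proof.
apply/eqP; rewrite eqEsubv; apply/andP; split; apply: span_of_sub => h.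
  case=> [Z [u [v [radu radv ->]]]]; apply: mem_span_of.
  have [D [pr [inc [hpr hinc incE]]]] := phi_sub_summand Z.
  exists D, (pr \o u)%VF, (v \o inc)%VF; split.
  - exact/(in_rad_res phi_surj)/in_rad_compl.
  - exact/(in_rad_res phi_surj)/in_rad_compr.
  apply/lfunP => x; rewrite !comp_lfunE /= incE // => l l0.
  by have [hu _] := radu; rewrite -hu annihilated_res // linear0.
case=> [Z [u [v [radu radv ->]]]]; apply: mem_span_of.
by exists (res phi Z), u, v; split=> //; apply/in_rad_res => //; apply: phi_surj.
Qed.

(** Dually, it factors through the largest quotient of the middle term that is
    a [B]-module. *)
Lemma rad2_psi (Y Y' : rmod B) : @rad2 K L (res psi Y) (res psi Y') = rad2 Y Y'.
Proof.
apply/eqP; rewrite eqEsubv; apply/andP; split; apply: span_of_sub => h.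
  case=> [Z [u [v [radu radv ->]]]]; apply: mem_span_of.
  have [D [pr [inc [hpr hinc incE]]]] := psi_quotient_summand Z.
  exists D, (pr \o u)%VF, (v \o inc)%VF; split.
  - exact/(in_rad_res psi_surj)/in_rad_compl.
  - exact/(in_rad_res psi_surj)/in_rad_compr.
  apply/lfunP => x; rewrite !comp_lfunE /=; apply/eqP; rewrite -subr_eq0 -linearB.
  have [hv _] := radv.
  have : (mulJ Z (in_ker psi) <= lker v)%VS.
    apply: span_of_sub => _ [z [l [l0 ->]]].
    by rewrite memv_ker hv annihilated_res.
  by move/subvP/(_ _ (incE (u x))); rewrite memv_ker.
case=> [Z [u [v [radu radv ->]]]]; apply: mem_span_of.
by exists (res psi Z), u, v; split=> //; apply/in_rad_res => //; apply: psi_surj.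
Qed.

Lemma irr_dim_phi (X X' : rmod A) : irr_dim (res phi X) (res phi X') = irr_dim X X'.
Proof. by rewrite /irr_dim rad2_phi (rad_res phi_surj). Qed.

Lemma irr_dim_psi (Y Y' : rmod B) : irr_dim (res psi Y) (res psi Y') = irr_dim Y Y'.
Proof. by rewrite /irr_dim rad2_psi (rad_res psi_surj). Qed.

Section Mixed.
Variables (X : rmod A) (Y : rmod B).
Hypotheses (indX : indecomposable X) (indY : indecomposable Y).
Hypotheses (nX : ~ annihilated F X) (nY : ~ annihilated G Y).

(** Here [X = X (ker psi)], whereas [ker psi] annihilates [Y]: there is no
    nonzero map. *)
Lemma irr_dim_phi_psi : irr_dim (res phi X) (res psi Y) = 0%N.
Proof.
apply/eqP; rewrite subn_eq0; apply: dimvS; apply: span_of_sub => h [hh _].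
have [/annihilated_res_phi//|U] :=
  indecomposable_annihilated (proj2 (indecomposable_res phi_surj X) indX).
suff -> : h = 0 by apply: mem0v.
apply/lfunP => x; rewrite zero_lfunE.
have : (mulJ (res phi X) (in_ker psi) <= lker h)%VS.
  apply: span_of_sub => _ [z [l [l0 ->]]].
  by rewrite memv_ker hh annihilated_res.
by rewrite U => /subvP/(_ x (memvf x)); rewrite memv_ker => /eqP.
Qed.

(** A map [Y -> X] factors through the quotient of [Y] by [Y (ker phi)]; the
    projection is not injective and the induced map is not surjective. *)
Lemma irr_dim_psi_phi : irr_dim (res psi Y) (res phi X) = 0%N.
Proof.
apply/eqP; rewrite subn_eq0; apply: dimvS; apply: span_of_sub => h [hh _].
apply: mem_span_of; pose N := mulJ (res psi Y) (in_ker phi).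
have sN : submod N by exact: mulJ_ker_submod.
have hq := is_hom_qproj sN.
have hN : (N <= lker h)%VS.
  apply: span_of_sub => _ [z [l [l0 ->]]].
  by rewrite memv_ker hh annihilated_res.
have [|h' h'E] := @linear_lfun _ (quot_rmod sN) (res phi X)
   (fun q : quot N => h (vsval q)).
  by move=> k u v; rewrite !linearP.
have h'q y : h' (qproj N y) = h y.
  apply/eqP; rewrite h'E -subr_eq0 -linearB -memv_ker (subvP hN) //.
  by rewrite -qproj_eq0 linearB /= qprojK subrr.
have hh' : is_hom h' by move=> l q; rewrite -[q]qprojK -hq !h'q hh.
exists (quot_rmod sN), (qproj N), h'; split.
- apply: noninj_in_rad => //; first exact/(indecomposable_res psi_surj).
  move=> /lker0_injP inj; apply: nY; apply/annihilated_res_psi => l l0 y.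
  by apply: inj; apply/eqP; rewrite qproj_eq0 mem_mulJ.
- apply: nonsurj_in_rad => //; first exact/(indecomposable_res phi_surj).
  move=> /limg_fullP surj; apply: nX; apply/annihilated_res_phi => l l0 x.
  have [q <-] := surj x; rewrite -hh' -[q]qprojK -hq.
  by rewrite annihilated_res // !linear0.
by apply/lfunP => y; rewrite comp_lfunE /= h'q.
Qed.

End Mixed.

End Pullback.

(** * Quivers with multiplicities *)

(** The Auslander--Reiten quivers have this form. Their arrows carry no structure
    besides their ends and a number, so a map of vertices that preserves
    multiplicities extends to the arrows. *)
Definition mquiver (V : Type) (d : V -> V -> nat) : quiver :=
  @Quiver V {xy : V * V & 'I_(d xy.1 xy.2)}
    (fun a => (tag a).1) (fun a => (tag a).2).

Section MultiplicityQuiver.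
Variables (V : Type) (d : V -> V -> nat).

Definition marrow x y (i : 'I_(d x y)) : arrow (mquiver d) :=
  existT (fun xy : V * V => 'I_(d xy.1 xy.2)) (x, y) i.

Lemma marrow_eq (a b : arrow (mquiver d)) : src a = src b -> tgt a = tgt b ->
  nat_of_ord (tagged a) = nat_of_ord (tagged b) -> a = b.
Proof.
move: a b => [[x y] i] [[x' y'] j] /= Ex Ey; subst x' y' => /val_inj /= ->.
by [].
Qed.

End MultiplicityQuiver.

Lemma sval_inj (T : Type) (P : T -> Prop) (u v : {x | P x}) :
  sval u = sval v -> u = v.
Proof.
by move: u v => [x px] [y py] /= xy; subst y; rewrite (Prop_irrelevance px py).
Qed.

Section SubMap.
Variables (V1 V2 : Type) (d1 : V1 -> V1 -> nat) (d2 : V2 -> V2 -> nat).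
Variables (S1 : V1 -> Prop) (S2 : V2 -> Prop) (s : {x | S1 x} -> {y | S2 y}).
Hypothesis ds : forall x y, d1 (sval x) (sval y) = d2 (sval (s x)) (sval (s y)).
Local Notation D1 := (@full_subquiver (mquiver d1) S1).
Local Notation D2 := (@full_subquiver (mquiver d2) S2).

Definition sub_arrow (a : arrow D1) : arrow D2 :=
  exist _ (marrow (cast_ord (ds (src a) (tgt a)) (tagged (sval a))))
    (conj (svalP (s (src a))) (svalP (s (tgt a)))).

Fact sub_arrow_src a : src (sub_arrow a) = s (src a).
Proof. exact: sval_inj. Qed.

Fact sub_arrow_tgt a : tgt (sub_arrow a) = s (tgt a).
Proof. exact: sval_inj. Qed.

Definition sub_map : qmor D1 D2 := QMor sub_arrow_src sub_arrow_tgt.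

End SubMap.

Lemma sub_mapK (V1 V2 : Type) (d1 : V1 -> V1 -> nat) (d2 : V2 -> V2 -> nat)
    (S1 : V1 -> Prop) (S2 : V2 -> Prop) (s : {x | S1 x} -> {y | S2 y})
    (t : {y | S2 y} -> {x | S1 x})
    (ds : forall x y, d1 (sval x) (sval y) = d2 (sval (s x)) (sval (s y)))
    (dt : forall x y, d2 (sval x) (sval y) = d1 (sval (t x)) (sval (t y))) :
  cancel s t -> cancel (sub_arrow ds) (sub_arrow dt).
Proof.
move=> sK a.
have Es := etrans (congr1 t (sub_arrow_src ds a)) (sK (src a)).
have Et := etrans (congr1 t (sub_arrow_tgt ds a)) (sK (tgt a)).
apply/sval_inj/marrow_eq => //.
  by have := congr1 sval Es.
by have := congr1 sval Et.
Qed.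

Lemma pushout_fun (X1 X2 X Y : Type) (j1 : X1 -> X) (j2 : X2 -> X)
    (f1 : X1 -> Y) (f2 : X2 -> Y) : injective j1 -> injective j2 ->
    (forall x, (exists a, j1 a = x) \/ (exists b, j2 b = x)) ->
    (forall a b, j1 a = j2 b -> f1 a = f2 b) ->
  exists f : X -> Y, (forall a, f (j1 a) = f1 a) /\ (forall b, f (j2 b) = f2 b).
Proof.
move=> inj1 inj2 cover agree.
have ex x : exists y, (forall a, j1 a = x -> y = f1 a) /\
    (forall b, j2 b = x -> y = f2 b).
  have [[a <-]|[b <-]] := cover x; [exists (f1 a)|exists (f2 b)].
    by split=> [a' /inj1->|b /esym/agree->].
  by split=> [a /agree->|b' /inj2->].
by have [f fE] := choice ex; exists f; split=> z;
  [have [h _] := fE (j1 z)|have [_ h] := fE (j2 z)]; apply: h.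
Qed.

Section Amalgam.
Variables (V1 V2 V : Type).
Variables (d1 : V1 -> V1 -> nat) (d2 : V2 -> V2 -> nat) (d : V -> V -> nat).
Variables (S1 : V1 -> Prop) (S2 : V2 -> Prop) (j1 : V1 -> V) (j2 : V2 -> V).
Hypotheses (inj1 : injective j1) (inj2 : injective j2).
Hypotheses (dj1 : forall x y, d1 x y = d (j1 x) (j1 y))
  (dj2 : forall x y, d2 x y = d (j2 x) (j2 y)).
Hypothesis cover : forall v, (exists x, j1 x = v) \/ (exists y, j2 y = v).
Hypotheses (S1P : forall x, S1 x <-> exists y, j1 x = j2 y)
  (S2P : forall y, S2 y <-> exists x, j1 x = j2 y).
Hypothesis mixed : forall x y, ~ S1 x -> ~ S2 y ->
  d (j1 x) (j2 y) = 0%N /\ d (j2 y) (j1 x) = 0%N.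

Lemma overlap_map : exists s : {x | S1 x} -> {y | S2 y},
  forall x, j1 (sval x) = j2 (sval (s x)).
Proof.
have ex (x : {x | S1 x}) : exists y : {y | S2 y}, j1 (sval x) = j2 (sval y).
  have /S1P[y xy] := svalP x.
  by have S2y : S2 y by [apply/S2P; exists (sval x)]; exists (exist _ y S2y).
by have [s sE] := choice ex; exists s.
Qed.

Lemma overlap_inv : exists t : {y | S2 y} -> {x | S1 x},
  forall y, j1 (sval (t y)) = j2 (sval y).
Proof.
have ex (y : {y | S2 y}) : exists x : {x | S1 x}, j1 (sval x) = j2 (sval y).
  have /S2P[x xy] := svalP y.
  by have S1x : S1 x by [apply/S1P; exists (sval y)]; exists (exist _ x S1x).
by have [t tE] := choice ex; exists t.
Qed.

Definition arrow_map (W : Type) (dW : W -> W -> nat) (j : W -> V)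
    (dj : forall x y, dW x y = d (j x) (j y)) : qmor (mquiver dW) (mquiver d) :=
  @QMor (mquiver dW) (mquiver d) j
    (fun a => marrow (cast_ord (dj (src a) (tgt a)) (tagged a)))
    (fun _ => erefl) (fun _ => erefl).

Lemma arrow_map_inj W dW j dj : injective j -> injective (qa (@arrow_map W dW j dj)).
Proof.
move=> injj a b ab; apply: marrow_eq.
- exact/injj/(congr1 (@src _) ab).
- exact/injj/(congr1 (@tgt _) ab).
exact: (congr1 (fun c : arrow (mquiver d) => nat_of_ord (tagged c)) ab).
Qed.

Lemma arrow_map_lift W dW j dj (a : arrow (mquiver d)) :
    (exists x, j x = src a) -> (exists y, j y = tgt a) ->
  exists b, qa (@arrow_map W dW j dj) b = a.
Proof.
move: a => [[u v] i] /= [x xu] [y yv]; subst u v.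
exists (marrow (cast_ord (esym (dj x y)) i)).
by apply: marrow_eq.
Qed.

Local Notation J1 := (arrow_map dj1).
Local Notation J2 := (arrow_map dj2).

(** An arrow between a vertex from the first quiver and one from the second has
    an end in the overlap, so that it lies in one of the two quivers. *)
Lemma arrow_cover (a : arrow (mquiver d)) :
  (exists b, qa J1 b = a) \/ (exists c, qa J2 c = a).
Proof.
have da : (0 < d (src a) (tgt a))%N.
  by case: (d _ _) (tagged a) => // -[].
have [[x xs]|[y ys]] := cover (src a); have [[x' xt]|[y' yt]] := cover (tgt a).
- by left; apply: arrow_map_lift; [exists x | exists x'].
- have [/S1P[y xy]|nS1] := pselect (S1 x).
    by right; apply: arrow_map_lift; [exists y; rewrite -xy | exists y'].
  have [/S2P[x' xy]|nS2] := pselect (S2 y').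
    by left; apply: arrow_map_lift; [exists x | exists x'; rewrite xy].
  by have [E _] := mixed nS1 nS2; rewrite -xs -yt E in da.
- have [/S1P[y' xy]|nS1] := pselect (S1 x').
    by right; apply: arrow_map_lift; [exists y | exists y'; rewrite -xy].
  have [/S2P[x xy]|nS2] := pselect (S2 y).
    by left; apply: arrow_map_lift; [exists x; rewrite xy | exists x'].
  by have [_ E] := mixed nS1 nS2; rewrite -ys -xt E in da.
by right; apply: arrow_map_lift; [exists y | exists y'].
Qed.

(** Vertices and arrows are each a pushout of sets. Two arrows with the same
    image have their ends in the overlap, where [ident] matches them. *)
Lemma amalgam : exists (ident : qmor (@full_subquiver (mquiver d1) S1)
                                     (@full_subquiver (mquiver d2) S2))
    (k1 : qmor (mquiver d1) (mquiver d)) (k2 : qmor (mquiver d2) (mquiver d)),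
  [/\ qiso ident,
      forall x y, qv ident x = y <-> j1 (sval x) = j2 (sval y),
      amalgamated_sum (@full_incl (mquiver d1) S1)
        (qcomp (@full_incl (mquiver d2) S2) ident) k1 k2
    & qv k1 = j1 /\ qv k2 = j2].
Proof.
have [s sE] := overlap_map; have [t tE] := overlap_inv.
have sK : cancel s t by move=> x; apply/sval_inj/inj1; rewrite tE.
have tK : cancel t s by move=> y; apply/sval_inj/inj2; rewrite -sE.
have ds x y : d1 (sval x) (sval y) = d2 (sval (s x)) (sval (s y)).
  by rewrite dj1 !sE -dj2.
have dt x y : d2 (sval x) (sval y) = d1 (sval (t x)) (sval (t y)).
  by rewrite dj1 !tE -dj2.
exists (sub_map ds), J1, J2; split=> //.
- split; first by exists t.
  by exists (sub_arrow dt); apply: sub_mapK.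
- move=> x y; split=> [<-|xy]; first exact: sE.
  by apply/sval_inj/inj2; rewrite -sE.
split.
  split=> [x|a]; first exact: sE.
  apply: (@marrow_eq _ d); [exact: (sE (src a))|exact: (sE (tgt a))|by []].
move=> R k1 k2 [kv ka].
have [fv [fv1 fv2]] : exists fv : V -> vert R,
    (forall x, fv (j1 x) = qv k1 x) /\ (forall y, fv (j2 y) = qv k2 y).
  apply: pushout_fun => // x y xy.
  have S1x : S1 x by apply/S1P; exists y.
  apply: etrans (kv (exist _ x S1x)) _; congr (qv k2 _); apply: inj2.
  by rewrite -sE.
have [fa [fa1 fa2]] : exists fa : arrow (mquiver d) -> arrow R,
    (forall b, fa (qa J1 b) = qa k1 b) /\ (forall c, fa (qa J2 c) = qa k2 c).
  apply: pushout_fun; [exact: arrow_map_inj|exact: arrow_map_inj|exact: arrow_cover|].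
  move=> b c bc.
  have E1 : j1 (src b) = j2 (src c) := congr1 (@src _) bc.
  have E2 : j1 (tgt b) = j2 (tgt c) := congr1 (@tgt _) bc.
  have Sb : S1 (src b) /\ S1 (tgt b).
    by split; apply/S1P; [exists (src c)|exists (tgt c)].
  apply: etrans (ka (exist _ b Sb)) _; congr (qa k2 _).
  apply: (@marrow_eq _ d2).
  - by apply: inj2; rewrite /= -sE.
  - by apply: inj2; rewrite /= -sE.
  exact: (congr1 (fun c : arrow (mquiver d) => nat_of_ord (tagged c)) bc).
have fsrc a : src (fa a) = fv (src a).
  have [[b <-]|[c <-]] := arrow_cover a; first by rewrite fa1 qmor_src fv1.
  by rewrite fa2 qmor_src fv2.
have ftgt a : tgt (fa a) = fv (tgt a).
  have [[b <-]|[c <-]] := arrow_cover a; first by rewrite fa1 qmor_tgt fv1.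
  by rewrite fa2 qmor_tgt fv2.
exists (@QMor (mquiver d) R fv fa fsrc ftgt) => // k [kv1 ka1] [kv2 ka2].
split=> [v|a].
  have [[x <-]|[y <-]] := cover v; first by rewrite /= fv1; apply: kv1.
  by rewrite /= fv2; apply: kv2.
have [[b <-]|[c <-]] := arrow_cover a; first by rewrite /= fa1; apply: ka1.
by rewrite /= fa2; apply: ka2.
Qed.

End Amalgam.

(** * Vertices of the Auslander--Reiten quiver *)

Section Vertices.
Variables (K : fieldType) (A : falgType K).
Implicit Types (x y : ar_vertex A) (M N : rmod A).

Lemma ar_repr_indecomposable x : indecomposable (ar_repr x).
Proof. exact: (s2valP (cid2 (svalP x))). Qed.

Lemma cls_eq M N (hM : indecomposable M) (hN : indecomposable N) :
  cls hM = cls hN <-> isom M N.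
Proof.
split=> [E|MN]; last first.
  apply: sval_inj; apply: funext => X; apply/propext; split.
    exact: isom_trans (isom_sym MN).
  exact: isom_trans MN.
have /= := congr1 (fun x : ar_vertex A => sval x N) E => ->.
exact: isom_refl.
Qed.

Lemma cls_repr x : cls (ar_repr_indecomposable x) = x.
Proof. by apply: sval_inj; rewrite /= -(s2valP' (cid2 (svalP x))). Qed.

Lemma ar_repr_cls M (hM : indecomposable M) : isom M (ar_repr (cls hM)).
Proof. by apply/(cls_eq hM (ar_repr_indecomposable _)); rewrite cls_repr. Qed.

End Vertices.

Section ResVertex.
Variables (K : fieldType) (L G : falgType K) (phi : {lrmorphism L -> G}).
Hypothesis phi_surj : forall g, exists l, phi l = g.

Definition res_vertex (x : ar_vertex G) : ar_vertex L :=
  cls (proj2 (indecomposable_res phi_surj (ar_repr x)) (ar_repr_indecomposable x)).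

Lemma res_vertex_inj : injective res_vertex.
Proof.
move=> x y /cls_eq /(isom_res phi_surj) xy.
by rewrite -[x]cls_repr -[y]cls_repr; apply/cls_eq.
Qed.

Lemma res_vertex_repr x : isom (res phi (ar_repr x)) (ar_repr (res_vertex x)).
Proof. exact: ar_repr_cls. Qed.

Lemma res_vertex_cls (X : rmod G) (hX : indecomposable X)
    (M : rmod L) (hM : indecomposable M) :
  isom (res phi X) M -> res_vertex (cls hX) = cls hM.
Proof.
move=> XM; apply/cls_eq; apply: isom_trans XM.
exact/(isom_res phi_surj)/isom_sym/ar_repr_cls.
Qed.

Lemma res_vertex_supported (M : rmod L) (hM : indecomposable M) :
  annihilated phi M -> exists x, res_vertex x = cls hM.
Proof.
move=> aM; have iso := res_desc phi_surj aM.
have iX : indecomposable (desc phi_surj aM).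
  exact/(indecomposable_res phi_surj)/(isom_indecomposable iso).
by exists (cls iX); apply: res_vertex_cls; apply: isom_sym.
Qed.

End ResVertex.

Theorem corollary2p39 (K : closedFieldType) (A B : falgType K)
    (basicA : basic_algebra A) (basicB : basic_algebra B)
    (dirA : representation_directed A) (dirB : representation_directed B)
    (P : rmod A) (I : rmod B)
    (abutP : left_abutment P) (abutI : right_abutment I)
    (* both of height h = n.+1, with fixed realizations *)
    (n : nat)
    (e : 'I_n.+1 -> A) (f : 'I_n -> A) (realP : realization P e f)
    (eps : 'I_n.+1 -> B) (g : 'I_n -> B) (realI : corealization I eps g)
    (fP : {lrmorphism A -> KA K n}) (hfP : collapse_map e f fP)
    (gI : {lrmorphism B -> KA K n}) (hgI : collapse_map eps g gI) :
  let L : falgType K := gluing fP gI in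
  let phi : {lrmorphism L -> A} := @glue_phi K A B (KA K n) fP gI in
  let psi : {lrmorphism L -> B} := @glue_psi K A B (KA K n) fP gI in
  exists (ident : qmor (foundation P) (foundation I))
         (jA : qmor (AR A) (AR L)) (jB : qmor (AR B) (AR L)),
  [/\ qiso ident,
      forall (x : vert (foundation P)) (y : vert (foundation I)),
        qv ident x = y <->
        isom (res phi (ar_repr (qv (foundation_incl P) x)))
             (res psi (ar_repr (qv (foundation_incl I) y))),
      amalgamated_sum (foundation_incl P) (qcomp (foundation_incl I) ident)
                      jA jB
    & forall (M : rmod L) (hM : indecomposable M),
        (supported phi M -> exists hA : indecomposable (coind phi M),
           qv jA (cls hA) = cls hM) /\
        (supported psi M -> exists hB : indecomposable (ind psi M),
           qv jB (cls hB) = cls hM)].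
Proof.
move=> L phi psi.
have [F_unit F_split foundP] := left_abutment_facts abutP realP hfP.
have [G_unit G_split foundI] := right_abutment_facts abutI realI hgI.
have F_surj := collapse_map_surj hfP; have G_surj := collapse_map_surj hgI.
have square (l : L) : fP (phi l) = gI (psi l).
  by apply/eqP; rewrite -mem_glue subvsP.
have pull a b : fP a = gI b -> exists l : L, phi l = a /\ psi l = b.
  move=> ab; have ab_in : (a, b) \in glue_space fP gI by rewrite mem_glue ab.
  exists (vsproj (glue_space fP gI) (a, b)).
  by rewrite /= /glue_phi /glue_psi vsprojK.
have inj (l : L) : phi l = 0 -> psi l = 0 -> l = 0.
  move=> l1 l2; apply: subvs_inj; rewrite linear0.
  by rewrite [LHS]surjective_pairing; congr pair.
have phiS := phi_surj pull G_surj; have psiS := psi_surj pull F_surj.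
pose jA := res_vertex phiS; pose jB := res_vertex psiS.
pose d (R : falgType K) (x y : ar_vertex R) := irr_dim (ar_repr x) (ar_repr y).
have dA x y : d A x y = d L (jA x) (jA y).
  rewrite /d -(irr_dim_phi square pull inj F_surj G_surj F_unit G_split).
  by apply: irr_dim_isom; apply: res_vertex_repr.
have dB x y : d B x y = d L (jB x) (jB y).
  rewrite /d -(irr_dim_psi square pull inj F_surj G_surj G_unit F_split).
  by apply: irr_dim_isom; apply: res_vertex_repr.
have supp := indecomposable_supported square pull inj G_surj G_unit F_split.
have cover v : (exists x, jA x = v) \/ (exists y, jB y = v).
  rewrite -[v]cls_repr; have [aM|aM] := supp _ (ar_repr_indecomposable v).
    by left; apply: res_vertex_supported.
  by right; apply: res_vertex_supported.
have SA x : subquotient (ar_repr x) P <-> exists y, jA x = jB y.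
  rewrite foundP; last exact: ar_repr_indecomposable.
  rewrite -(annihilated_res_phi square pull); split=> [aX|[y /cls_eq xy]].
    have [y yE] := res_vertex_supported psiS
      (proj2 (indecomposable_res phiS (ar_repr x)) (ar_repr_indecomposable x)) aX.
    by exists y; rewrite [RHS]yE.
  exact: annihilated_isom (isom_sym xy) (@annihilated_res _ _ _ psi _).
have SB y : subquotient (ar_repr y) I <-> exists x, jA x = jB y.
  rewrite foundI; last exact: ar_repr_indecomposable.
  rewrite -(annihilated_res_psi square pull); split=> [aY|[x /cls_eq xy]].
    have [x xE] := res_vertex_supported phiS
      (proj2 (indecomposable_res psiS (ar_repr y)) (ar_repr_indecomposable y)) aY.
    by exists x; rewrite [LHS]xE.
  exact: annihilated_isom xy (@annihilated_res _ _ _ phi _).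
have mixed x y : ~ subquotient (ar_repr x) P -> ~ subquotient (ar_repr y) I ->
    d L (jA x) (jB y) = 0%N /\ d L (jB y) (jA x) = 0%N.
  rewrite foundP ?foundI; [|exact: ar_repr_indecomposable..] => nx ny.
  have [iX iY] := (ar_repr_indecomposable x, ar_repr_indecomposable y).
  split; rewrite /d.
    rewrite -(irr_dim_isom (res_vertex_repr phiS x) (res_vertex_repr psiS y)).
    exact: (irr_dim_phi_psi square pull inj G_surj G_unit F_split).
  rewrite -(irr_dim_isom (res_vertex_repr psiS y) (res_vertex_repr phiS x)).
  exact: (irr_dim_psi_phi square pull F_surj G_surj).
have [ident [k1 [k2 [ident_iso identE amal [k1E k2E]]]]] :=
  amalgam (@res_vertex_inj _ _ _ _ phiS) (@res_vertex_inj _ _ _ _ psiS)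
    dA dB cover SA SB mixed.
exists ident, k1, k2; split=> //.
  by move=> x y; rewrite identE; apply: cls_eq.
move=> M hM; rewrite k1E k2E; split=> /supportedP suppM.
  have iso := res_coind phiS (suppM phiS).
  have hA : indecomposable (coind phi M).
    exact/(indecomposable_res phiS)/(isom_indecomposable (isom_sym iso)).
  by exists hA; apply: res_vertex_cls.
have iso := res_ind psiS (suppM psiS).
have hB : indecomposable (ind psi M).
  exact/(indecomposable_res psiS)/(isom_indecomposable iso).
by exists hB; apply: res_vertex_cls; apply: isom_sym.
Qed.
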